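(* Let $v_t$ be a (time-varying) vector field over $\mathcal{T}\Theta$, and let $\rho_t$ be a solution of the continuity equation $\partial_t\rho_t=-\nabla\cdot(\rho_t v_t)$ with initial condition $\rho_0\in\mathcal{P}(\mathcal{T}\Theta)$. Let $\mathcal{V}:\mathcal{P}(\mathcal{T}\Theta)\to\mathbb{R}$, and suppose that along $\rho_t$, $\mathcal{V}$ is Fréchet differentiable and $\mathcal{V}'(\rho_t):\mathcal{T}\Theta\to\mathbb{R}$ is differentiable. Then for all $t\ge0$, $$\partial_t\mathcal{V}(\rho_t)=\langle\nabla\mathcal{V}'(\rho_t),\rho_t v_t\rangle_* .$$
   Context: $\Theta=\mathbb{R}^d$ and $\mathcal{T}\Theta=\mathbb{R}^d\times\mathbb{R}^d$ is its tangent bundle, with points $(\theta,r)$; a vector field over $\mathcal{T}\Theta$ takes values in $\mathbb{R}^d\times\mathbb{R}^d$. $\mathcal{P}(\mathcal{T}\Theta)$ is the set of probability density functions on $\mathcal{T}\Theta$ with respect to Lebesgue measure. The Fréchet differential $\mathcal{V}'(\rho)$ is identified with a function on $\mathcal{T}\Theta$ through the pairing $\langle f,h\rangle=\int_{\mathcal{T}\Theta}f h\,\mathrm{d}\theta\,\mathrm{d}r$. $\nabla$ and $\nabla\cdot$ are the Euclidean gradient and divergence in $(\theta,r)$. For vector fields $u,w$ on $\mathcal{T}\Theta$, $\langle u,w\rangle_*:=\int_{\mathcal{T}\Theta}\langle u(\theta,r),w(\theta,r)\rangle\,\mathrm{d}\theta\,\mathrm{d}r$, the integrand being the Euclidean inner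 product.
   Formalization: Added: for all t≥0, ⟨∇V'(ρ_t),ρ_t v_t⟩ and V'(ρ_t)|ρ_t v_t| are integrable (without no flux at infinity the claim can fail); ρ_t v_t is differentiable, and the continuity equation holds as a time derivative in the normed space used for Fréchet differentiability of V. *)

(* Defs.v *)
From HB Require Import structures.
From mathcomp Require Import all_boot all_order all_algebra.
From mathcomp Require Import all_classical all_reals all_analysis.

Set Implicit Arguments.
Unset Strict Implicit.
Unset Printing Implicit Defensive.
Import Order.TTheory GRing.Theory Num.Theory.
Import numFieldNormedType.Exports.
Local Open Scope classical_set_scope.
Local Open Scope ring_scope.

(* Row vectors carry the sigma-algebra generated by their coordinates, as
   [n.-tuple T] does. *)
Definition measure_rV_display : measure_display -> measure_display.
Proof. exact. Qed.

Section measurable_rV.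
Context {d} {T : measurableType d}.
Variable n : nat.

Let coors : 'I_n -> 'rV[T]_n -> T := fun i x => x ord0 i.

Let rV_set0 : g_sigma_preimage coors set0.
Proof. exact: sigma_algebra0. Qed.

Let rV_setC A : g_sigma_preimage coors A -> g_sigma_preimage coors (~` A).
Proof. exact: sigma_algebraC. Qed.

Let rV_bigcup (F : _^nat) : (forall i, g_sigma_preimage coors (F i)) ->
  g_sigma_preimage coors (\bigcup_i (F i)).
Proof. exact: sigma_algebra_bigcup. Qed.

HB.instance Definition _ := @isMeasurable.Build (measure_rV_display d)
  'rV[T]_n (g_sigma_preimage coors) rV_set0 rV_setC rV_bigcup.

End measurable_rV.

Section measurable_rV_theory.
Context d1 d2 (T1 : measurableType d1) (T2 : measurableType d2).

Lemma measurable_rV_coord n (i : 'I_n) :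
  measurable_fun [set: 'rV[T2]_n] (fun x : 'rV[T2]_n => x ord0 i).
Proof.
move=> _ Y mY; rewrite setTI; apply: sub_sigma_algebra => /=.
rewrite -bigcup_seq/=; exists i => /=; first by rewrite mem_index_enum.
by exists Y => //; rewrite setTI.
Qed.

Lemma measurable_fun_rVP n (f : T1 -> 'rV[T2]_n) :
  (forall i, measurable_fun [set: T1] (fun x => f x ord0 i)) ->
  measurable_fun [set: T1] f.
Proof.
move=> mf _ A mA; rewrite setTI.
pose S : set (set 'rV[T2]_n) := [set B | measurable (f @^-1` B)].
suff : (@measurable _ 'rV[T2]_n) `<=` S by apply.
apply: smallest_sub.
  split=> [|B mB|F mF]; rewrite /S/=.
  - by rewrite preimage_set0; exact: measurable0.
  - by rewrite setTD -preimage_setC; exact: measurableC.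
  - by rewrite preimage_bigcup; apply: bigcup_measurable => k _; exact: mF.
move=> B; rewrite -bigcup_seq => -[i _ [C mC <-]]; rewrite /S/= setTI.
by have := mf i measurableT C mC; rewrite setTI.
Qed.

End measurable_rV_theory.

(* The canonical sigma-finite structure on [m1 \x m2] is keyed on
   subprobabilities, so the sigma-finite case is stated separately. *)
Lemma sigma_finite_product_measure1 d1 d2 (T1 : measurableType d1)
    (T2 : measurableType d2) (R : realType)
    (m1 : {sigma_finite_measure set T1 -> \bar R})
    (m2 : {sigma_finite_measure set T2 -> \bar R}) :
  sigma_finite setT (m1 \x m2)%E.
Proof.
have /sigma_finiteP[F [TF ndF Foo]] := sigma_finiteT m1.
have /sigma_finiteP[G [TG ndG Goo]] := sigma_finiteT m2.
exists (fun n => F n `*` G n).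
  rewrite -setXTT TF TG predeqE => -[x y]; split.
    move=> [/= [n _ Fnx] [k _ Gky]]; exists (maxn n k) => //; split.
    - by move: x Fnx; exact/subsetPset/ndF/leq_maxl.
    - by move: y Gky; exact/subsetPset/ndG/leq_maxr.
  by move=> [n _ []/= ? ?]; split; exists n.
move=> k; have [? ?] := Foo k; have [? ?] := Goo k.
split; first exact: measurableX.
by rewrite product_measure1E// lte_mul_pinfty// ge0_fin_numE.
Qed.

Section lebesgue_rV.
Context {R : realType}.

Definition rV_cons n (p : measurableTypeR R * 'rV[R]_n) : 'rV[R]_(1 + n) :=
  row_mx (p.1 : R)%:M p.2.

Lemma measurable_rV_cons n : measurable_fun setT (@rV_cons n).
Proof.
apply: measurable_fun_rVP => i; rewrite /rV_cons.
case: (split_ordP i) => j ->.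
  rewrite (_ : (fun _ => _) = fst) //.
  by apply/funext => x; rewrite row_mxEl (ord1 j) mxE mulr1n.
rewrite (_ : (fun _ => _) = (fun x : 'rV[R]_n => x ord0 j) \o snd); last first.
  by apply/funext => x; rewrite row_mxEr.
by apply: measurableT_comp => //; exact: measurable_rV_coord.
Qed.

Section step.
Variables (n : nat) (m : {sigma_finite_measure set 'rV[R]_n -> \bar R}).

Definition lebesgue_rV_step : set 'rV[R]_(1 + n) -> \bar R :=
  pushforward (@lebesgue_measure R \x m)%E (@rV_cons n).

Let step0 : lebesgue_rV_step set0 = 0%E.
Proof. by rewrite /lebesgue_rV_step /pushforward preimage_set0 measure0. Qed.

Let step_ge0 A : (0 <= lebesgue_rV_step A)%E.
Proof. by rewrite /lebesgue_rV_step /pushforward; exact: measure_ge0. Qed.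

Let measurable_preimage_cons A : measurable A -> measurable (@rV_cons n @^-1` A).
Proof. by move=> mA; rewrite -[X in measurable X]setTI; exact: measurable_rV_cons. Qed.

Let step_sigma_additive : semi_sigma_additive lebesgue_rV_step.
Proof.
move=> F mF tF mUF; rewrite /lebesgue_rV_step /pushforward preimage_bigcup.
apply: measure_semi_sigma_additive.
- by move=> k; exact: measurable_preimage_cons.
- apply/trivIsetP => /= i j _ _ ij; rewrite -preimage_setI.
  by move/trivIsetP : tF => /(_ _ _ _ _ ij) ->//; rewrite preimage_set0.
- by rewrite -preimage_bigcup; exact: measurable_preimage_cons.
Qed.

HB.instance Definition _ := isMeasure.Build _ _ _ lebesgue_rV_step
  step0 step_ge0 step_sigma_additive.

Let uncons (w : 'rV[R]_(1 + n)) : measurableTypeR R * 'rV[R]_n :=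
  (w ord0 (lshift n ord0), rsubmx w).

Let consK : cancel (@rV_cons n) uncons.
Proof.
by move=> [x w]; rewrite /rV_cons /uncons row_mxKr row_mxEl mxE.
Qed.

Let unconsK : cancel uncons (@rV_cons n).
Proof.
move=> w; rewrite /rV_cons /uncons/= -[RHS]hsubmxK; congr row_mx.
by apply/matrixP => i j; rewrite !ord1 !mxE mulr1n.
Qed.

Let measurable_uncons : measurable_fun setT uncons.
Proof.
apply: measurable_fun_pair; first exact: measurable_rV_coord.
apply: measurable_fun_rVP => i.
rewrite (_ : (fun _ => _) = fun w : 'rV_(1 + n) => w ord0 (rshift 1 i)).
  exact: measurable_rV_coord.
by apply/funext => w; rewrite mxE.
Qed.

Let step_sigma_finite : sigma_finite setT lebesgue_rV_step.
Proof.
have [F FT mF] : sigma_finite setT (@lebesgue_measure R \x m)%E.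
  exact: sigma_finite_product_measure1.
exists (fun k => uncons @^-1` (F k)).
  by rewrite -preimage_bigcup -FT preimage_setT.
move=> k; have [mFk Fk_fin] := mF k; split.
  by rewrite -[X in measurable X]setTI; exact: measurable_uncons.
rewrite /lebesgue_rV_step /pushforward -comp_preimage.
by rewrite (_ : uncons \o _ = idfun) //; apply/funext => p; exact: consK.
Qed.

HB.instance Definition _ := @Measure_isSigmaFinite.Build _ _ _
  lebesgue_rV_step step_sigma_finite.

End step.

Fixpoint lebesgue_rV n : {sigma_finite_measure set 'rV[R]_n -> \bar R} :=
  match n with
  | 0 => \d_(0 : 'rV[R]_0)
  | n'.+1 => lebesgue_rV_step (lebesgue_rV n')
  end.

(* Together with sigma-finiteness, this characterizes Lebesgue measure. *)
Lemma lebesgue_rV_box n (A : 'I_n -> set R) : (forall i, measurable (A i)) ->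
  lebesgue_rV n [set x : 'rV[R]_n | forall i, A i (x ord0 i)] =
  (\prod_(i < n) lebesgue_measure (A i))%E.
Proof.
elim: n => [|n IHn] in A *; move=> mA.
  by rewrite big_ord0 /= diracE mem_set //= => -[].
rewrite big_ord_recl /= -(IHn (fun i => A (lift ord0 i))) //.
have mB : measurable [set x : 'rV[R]_n | forall i, A (lift ord0 i) (x ord0 i)].
  rewrite (_ : [set x | _] = \bigcap_(i in [set: 'I_n])
      ((fun x : 'rV[R]_n => x ord0 i) @^-1` A (lift ord0 i))).
    apply: fin_bigcap_measurable => // i _.
    by rewrite -[X in measurable X]setTI; exact: measurable_rV_coord.
  by apply/seteqP; split=> x xA => [i _|i]; exact: xA.
rewrite -product_measure1E //; last exact: (mA ord0).
have cons0 (p : measurableTypeR R * 'rV[R]_n) : rV_cons p ord0 ord0 = p.1.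
  transitivity (rV_cons p ord0 (lshift n ord0)).
    by congr (rV_cons p _ _); exact/val_inj.
  by rewrite /rV_cons row_mxEl mxE mulr1n.
have consS (p : measurableTypeR R * 'rV[R]_n) i :
    rV_cons p ord0 (lift ord0 i) = p.2 ord0 i.
  transitivity (rV_cons p ord0 (rshift 1 i)).
    by congr (rV_cons p _ _); exact/val_inj.
  by rewrite /rV_cons row_mxEr.
apply: (congr1 (lebesgue_measure \x lebesgue_rV n)%E).
apply/seteqP; split=> -[x w] /=.
  move=> xwA; split=> [|i].
    by have := xwA ord0; rewrite cons0.
  by have := xwA (lift ord0 i); rewrite consS.
move=> [xA wA] i; case: (unliftP ord0 i) => [j ->|->].
  by rewrite consS; exact: wA.
by rewrite cons0.
Qed.

End lebesgue_rV.

Section tangent_bundle.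
Context {R : realType} {d : nat}.
Local Notation T := ('rV[R]_d * 'rV[R]_d)%type.

Definition lebesgue_T : {measure set T -> \bar R} :=
  (lebesgue_rV d \x lebesgue_rV d)%E.

Definition gradient (f : T -> R) (x : T) : T :=
  (\row_(i < d) 'D_((delta_mx ord0 i, 0) : T) f x,
   \row_(i < d) 'D_((0, delta_mx ord0 i) : T) f x).

Definition divergence (u : T -> T) (x : T) : R :=
  \sum_(i < d) 'D_((delta_mx ord0 i, 0) : T) (fun y => (u y).1 ord0 i) x +
  \sum_(i < d) 'D_((0, delta_mx ord0 i) : T) (fun y => (u y).2 ord0 i) x.

Definition dotT (a b : T) : R :=
  \sum_(i < d) a.1 ord0 i * b.1 ord0 i + \sum_(i < d) a.2 ord0 i * b.2 ord0 i.

Definition pairing (f h : T -> R) : R := \int[lebesgue_T]_x (f x * h x).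

Definition pairing_vf (u w : T -> T) : R :=
  \int[lebesgue_T]_x dotT (u x) (w x).

Definition densities : set (T -> R) :=
  [set rho : T -> R | [/\ measurable_fun setT rho, forall x, 0 <= rho x &
                              (\int[lebesgue_T]_x (rho x)%:E = 1)%E]].

(* A normed space of functions, e.g. L^p or a weighted L^p. Elements are
   functions rather than classes: [nfs_norm] vanishes exactly on the functions
   that are zero almost everywhere. *)
Record normed_fun_space := NormedFunSpace {
  nfs_dom : set (T -> R) ;
  nfs_norm : (T -> R) -> R ;
  nfs_measurable : forall f : T -> R, nfs_dom f -> measurable_fun setT f ;
  nfs_zero : nfs_dom (cst 0) ;
  nfs_add : forall f g, nfs_dom f -> nfs_dom g -> nfs_dom (f \+ g) ;
  nfs_scale : forall a f, nfs_dom f -> nfs_dom (a \*o f) ;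
  nfs_normD : forall f g, nfs_dom f -> nfs_dom g ->
    nfs_norm (f \+ g) <= nfs_norm f + nfs_norm g ;
  nfs_normZ : forall a f, nfs_dom f ->
    nfs_norm (a \*o f) = `|a| * nfs_norm f ;
  nfs_norm_eq0 : forall f, nfs_dom f ->
    nfs_norm f = 0 <-> {ae lebesgue_T, forall x, f x = 0}
}.

(* [g] is the Frechet differential at [rho], for the norm of [E], of a
   functional [V] defined on probability densities only: perturbations of [rho]
   range over the densities in [E], and [h |-> pairing g h] is a continuous
   linear form on [E]. *)
Definition is_frechet_differential (E : normed_fun_space) (V : (T -> R) -> R)
    (rho g : T -> R) : Prop :=
  [/\ forall h, nfs_dom E h ->
        lebesgue_T.-integrable setT (fun x => (g x * h x)%:E),
      exists C, forall h, nfs_dom E h -> `|pairing g h| <= C * nfs_norm E h &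
      forall e, 0 < e -> exists2 delta, 0 < delta &
        forall rho', densities rho' -> nfs_dom E rho' ->
          nfs_norm E (rho' \- rho) < delta ->
          `|V rho' - V rho - pairing g (rho' \- rho)|
            <= e * nfs_norm E (rho' \- rho)].

(* Increments [h] such that [t + h] stays in [0, +oo[: derivatives in time are
   two-sided for [t > 0] and right derivatives at [t = 0]. *)
Definition time_increments (t : R) : set_system R :=
  within [set h | 0 <= t + h] (0 : R)^'.

(* The continuity equation on [0, +oo[: the space divergence is the classical
   one, and the time derivative is that of the curve [rho] in [E]. *)
Definition continuity_equation (E : normed_fun_space) (v : R -> T -> T)
    (rho : R -> T -> R) : Prop :=
  forall t, 0 <= t ->
    let flux := fun x => rho t x *: v t x in
    [/\ nfs_dom E (rho t), forall x, differentiable flux x,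
        nfs_dom E (divergence flux) &
        nfs_norm E (fun x => h^-1 * (rho (t + h) x - rho t x) + divergence flux x)
          @[h --> time_increments t] --> 0].

Definition has_time_derivative (f : R -> R) (t l : R) : Prop :=
  h^-1 * (f (t + h) - f t) @[h --> time_increments t] --> l.

End tangent_bundle.
Arguments normed_fun_space : clear implicits.

(* Main.v *)
(* Frechet differentiability and the continuity equation reduce the claim to
   the divergence theorem [int div u = 0] for [u = V'(rho_t) rho_t v_t]. This
   [u] is differentiable everywhere but not C^1, and only its divergence, not
   each partial derivative, is integrable; so Fubini does not apply and the
   proof is a Goursat-style subdivision. To avoid boundary integrals, cubes are
   replaced by tensor products [bump c s] of hat functions, which are positive
   combinations of their translates at scale [s / 2]. Let [w] majorize
   [div u + M] near every point. If [int w bump >= M int bump - int u . D bump]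
   failed at some cube by a fixed fraction of its volume, it would fail so at
   one of its subcubes, and hence on cubes shrinking to a point [x], against
   the differentiability of [u] at [x]. By a Vitali-Caratheodory argument [w]
   can be taken close to [max (div u) (- M) + M] in mean; letting the cube and
   [M] grow gives [0 <= int div u], and the same for [- u]. *)
Require Import Defs.
From HB Require Import structures.
From mathcomp Require Import all_boot all_order all_algebra.
From mathcomp Require Import all_classical all_reals all_analysis.
From mathcomp Require Import measurable_realfun ring lra.

Set Implicit Arguments.
Unset Strict Implicit.
Unset Printing Implicit Defensive.
Import Order.TTheory GRing.Theory Num.Theory.
Import numFieldNormedType.Exports.
Local Open Scope classical_set_scope.
Local Open Scope ring_scope.

(** * Hat functions and their refinement *)

Section hat.
Context {R : realType}.
Implicit Types (a b c s t : R).
Local Notation leb := (@lebesgue_measure R).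

Lemma indic_itvco a b t : \1_`[a, b[%classic t = (a <= t < b)%R%:R :> R.
Proof. by rewrite indicE mem_setE in_itv. Qed.

Lemma integrable_affine_indic a b p q : a <= b ->
  leb.-integrable setT (EFin \o (fun t => \1_`[a, b[%classic t * (p * t + q))).
Proof.
move=> ab.
have mf : measurable_fun setT (fun t : R => p * t + q).
  by apply: measurable_funD => //; exact: measurable_funM.
apply: (@le_integrable _ (measurableTypeR R) R leb setT measurableT _ (EFin \o
   (fun t => (`|p| * (`|a| + `|b|) + `|q|) * \1_`[a, b[%classic t))).
- by apply/measurable_EFinP; apply: measurable_funM.
- move=> t _ /=; rewrite lee_fin !normrM indicE.
  case: (boolP (t \in _)) => [|_]; last by rewrite normr0 mul0r mulr0.
  rewrite inE /= in_itv /= => /andP[at_ tb]; rewrite normr1 mul1r mulr1.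
  rewrite (le_trans (ler_normD _ _))// [leRHS]ger0_norm ?addr_ge0 ?mulr_ge0//.
  rewrite lerD2r normrM ler_wpM2l// ler_norml; apply/andP; split.
    have := ler_norm (- a); have := normr_ge0 b; rewrite normrN; lra.
  have := ler_norm b; have := normr_ge0 a; lra.
- have := integrableZl measurableT (`|p| * (`|a| + `|b|) + `|q|)
    (integrable_indic_itv a b true true).
  by apply: eq_integrable.
Qed.

Lemma Rintegral_affine_indic a b p q : a <= b ->
  \int[leb]_t (\1_`[a, b[%classic t * (p * t + q)) =
  p * ((b ^+ 2 - a ^+ 2) / 2) + q * (b - a).
Proof.
move=> ab; have iq := integrable_affine_indic p q ab.
have -> : \int[leb]_t (\1_`[a, b[%classic t * (p * t + q)) =
    \int[leb]_(t in `[a, b[%classic) (p * t + q).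
  rewrite [RHS]Rintegral_mkcond; apply: eq_Rintegral => t _.
  by rewrite /patch indicE; case: ifP => _; rewrite ?mul1r ?mul0r.
move: ab; rewrite le_eqVlt => /orP[/eqP ->|ab].
  by rewrite set_itvco0 ?lexx// Rintegral_set0; ring.
rewrite Rintegral_itv_bndo_bndc; last first.
  apply/integrable_mkcond => //; apply: eq_integrable iq => // t _ /=.
  by rewrite /patch indicE; case: ifP => _; rewrite ?mul1r ?mul0r.
have cF : continuous (fun t => p * (t ^+ 2 / 2) + q * t).
  move=> t; apply: cvgD; (apply: cvgM; first exact: cvg_cst); last exact: cvg_id.
  by apply: cvgM; [exact: exprn_continuous|exact: cvg_cst].
rewrite /Rintegral (@continuous_FTC2 _ _ (fun t => p * (t ^+ 2 / 2) + q * t)) //.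
- by rewrite -EFinB /=; ring.
- apply: continuous_subspaceT => t.
  apply: cvgD; last exact: cvg_cst.
  by apply: cvgM; [exact: cvg_cst|exact: cvg_id].
- split => [t _| |].
  + by apply: ex_derive.
  + by apply: cvg_at_right_filter; exact: cF.
  + by apply: cvg_at_left_filter; exact: cF.
- move=> t _; rewrite derive1E; apply: derive_val.
  by apply: is_derive_eq; rewrite /GRing.scale/=; field.
Qed.

(** The linear B-spline with peak 1 at [c] and support of radius [s]. Half-open indicators keep the
    two branches from overlapping at the peak. *)
Definition hat c s t : R :=
  \1_`[c - s, c[%classic t * ((t - c + s) / s) +
  \1_`[c, c + s[%classic t * ((c + s - t) / s).

(* The derivative of [hat c s], with a half-open convention at the three kinks
   that makes the refinement equation [dhat_refine] hold at every point. *)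
Definition dhat c s t : R :=
  (\1_`[c - s, c[%classic t - \1_`[c, c + s[%classic t) / s.

(** Mask 1/2, 1, 1/2 of the two-scale relation of the linear B-spline; the children are centred at
    [c - s / 2], [c] and [c + s / 2]. *)
Definition refine_wt (k : 'I_3) : R := if k == 1 then 1 else 2^-1.

Definition refine_ctr c s (k : 'I_3) : R := c + (k%:R - 1) * (s / 2).

Let hat_affine c s : hat c s = fun t =>
  \1_`[c - s, c[%classic t * (s^-1 * t + (s - c) / s) +
  \1_`[c, c + s[%classic t * (- s^-1 * t + (c + s) / s).
Proof. by apply/funext => t; rewrite /hat; congr (_ * _ + _ * _); ring. Qed.

Let dhat_affine c s : dhat c s = fun t =>
  \1_`[c - s, c[%classic t * (0 * t + s^-1) +
  \1_`[c, c + s[%classic t * (0 * t - s^-1).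
Proof. by apply/funext => t; rewrite /dhat; ring. Qed.

Let xdhat_affine c s : (fun t => (t - c) * dhat c s t) = fun t =>
  \1_`[c - s, c[%classic t * (s^-1 * t - c / s) +
  \1_`[c, c + s[%classic t * (- s^-1 * t + c / s).
Proof. by apply/funext => t; rewrite /dhat; ring. Qed.

Let absdhat_affine c s : 0 < s -> (fun t => `|dhat c s t|) = fun t =>
  \1_`[c - s, c[%classic t * (0 * t + s^-1) +
  \1_`[c, c + s[%classic t * (0 * t + s^-1).
Proof.
move=> s0; apply/funext => t.
rewrite /dhat normrM (gtr0_norm (x := s^-1)) ?invr_gt0// !indic_itvco.
rewrite !mul0r !add0r -mulrDl; congr (_ * _).
case: (ltP t c) => tc; rewrite ?andbF ?andbT /= ?addr0 ?subr0 ?add0r ?sub0r ?normrN.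
  by rewrite ger0_norm.
by rewrite ger0_norm.
Qed.

(** Every one-dimensional integral needed for [hat] and [dhat] is that of a function affine on each
    half of the support, so one computation covers them all. *)
Let pieces p q p' q' c s : 0 <= s ->
  let f t := \1_`[c - s, c[%classic t * (p * t + q) +
             \1_`[c, c + s[%classic t * (p' * t + q') in
  leb.-integrable setT (EFin \o f) /\
  \int[leb]_t f t =
    p * ((c ^+ 2 - (c - s) ^+ 2) / 2) + q * s +
    (p' * (((c + s) ^+ 2 - c ^+ 2) / 2) + q' * s).
Proof.
move=> s0 f.
have le1 : c - s <= c by rewrite lerBlDr lerDl.
have le2 : c <= c + s by rewrite lerDl.
have i1 := integrable_affine_indic p q le1.
have i2 := integrable_affine_indic p' q' le2.
split.
  by have := integrableD measurableT i1 i2; exact: eq_integrable.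
rewrite RintegralD// !Rintegral_affine_indic//; ring.
Qed.

Lemma integrable_hat c s : 0 < s -> leb.-integrable setT (EFin \o hat c s).
Proof. by move=> /ltW s0; rewrite hat_affine; exact: (pieces _ _ _ _ c s0).1. Qed.

Lemma Rintegral_hat c s : 0 < s -> \int[leb]_t hat c s t = s.
Proof.
move=> s0; rewrite hat_affine.
have [_ ->] := pieces (s^-1) ((s - c) / s) (- s^-1) ((c + s) / s) c (ltW s0).
by field; rewrite gt_eqF.
Qed.

Lemma integrable_dhat c s : 0 < s -> leb.-integrable setT (EFin \o dhat c s).
Proof. by move=> /ltW s0; rewrite dhat_affine; exact: (pieces _ _ _ _ c s0).1. Qed.

Lemma Rintegral_dhat c s : 0 < s -> \int[leb]_t dhat c s t = 0.
Proof.
move=> s0; rewrite dhat_affine.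
have [_ ->] := pieces 0 s^-1 0 (- s^-1) c (ltW s0).
by field; rewrite gt_eqF.
Qed.

Lemma integrable_xdhat c s : 0 < s ->
  leb.-integrable setT (EFin \o (fun t => (t - c) * dhat c s t)).
Proof. by move=> /ltW s0; rewrite xdhat_affine; exact: (pieces _ _ _ _ c s0).1. Qed.

(** Integration by parts: this first moment is minus the integral of [hat c s]. *)
Lemma Rintegral_xdhat c s : 0 < s -> \int[leb]_t ((t - c) * dhat c s t) = - s.
Proof.
move=> s0; rewrite xdhat_affine.
have [_ ->] := pieces s^-1 (- (c / s)) (- s^-1) (c / s) c (ltW s0).
by field; rewrite gt_eqF.
Qed.

Lemma Rintegral_norm_dhat c s : 0 < s -> \int[leb]_t `|dhat c s t| = 2.
Proof.
move=> s0; rewrite absdhat_affine//.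
have [_ ->] := pieces 0 s^-1 0 s^-1 c (ltW s0).
by field; rewrite gt_eqF.
Qed.

Lemma measurable_hat c s : measurable_fun setT (hat c s).
Proof.
rewrite hat_affine; apply: measurable_funD; apply: measurable_funM => //;
  by apply: measurable_funD => //; exact: measurable_funM.
Qed.

Lemma measurable_dhat c s : measurable_fun setT (dhat c s).
Proof.
by apply: measurable_funM => //; apply: measurable_funB.
Qed.

Lemma hat_ge0 c s t : 0 < s -> 0 <= hat c s t.
Proof.
move=> s0; rewrite /hat !indic_itvco; apply: addr_ge0.
  case: (boolP (_ && _)) => [/andP[? ?]|_]; last by rewrite mul0r.
  by rewrite mul1r divr_ge0//; lra.
case: (boolP (_ && _)) => [/andP[? ?]|_]; last by rewrite mul0r.
by rewrite mul1r divr_ge0//; lra.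
Qed.

Lemma hat_le1 c s t : 0 < s -> hat c s t <= 1.
Proof.
move=> s0; rewrite /hat !indic_itvco.
case: (ltP t c) => tc; rewrite ?andbF ?andbT /=.
  case: (boolP (c - s <= t)) => [?|_]; rewrite /= !mul0r addr0// mul1r.
  by rewrite ler_pdivrMr//; lra.
case: (boolP (t < c + s)) => [?|_]; rewrite /= !mul0r add0r// mul1r.
by rewrite ler_pdivrMr//; lra.
Qed.

Lemma norm_dhat_le c s t : 0 < s -> `|dhat c s t| <= s^-1.
Proof.
move=> s0; rewrite /dhat !indic_itvco normrM (gtr0_norm (x := s^-1)) ?invr_gt0//.
rewrite ler_piMl ?invr_ge0 ?(ltW s0)//.
by case: (ltP t c) => tc; rewrite ?andbF ?andbT /=;
  case: (c - s <= t); case: (t < c + s) => /=;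
  rewrite ?subr0 ?sub0r ?normrN ?normr1 ?normr0.
Qed.

Let hat_dhat_supp c s t : s < `|t - c| -> hat c s t = 0 /\ dhat c s t = 0.
Proof.
rewrite /hat /dhat !indic_itvco => st.
have -> : (c - s <= t < c) = false.
  apply/negbTE/negP => /andP[? ?]; move: st; rewrite ltr_normr; lra.
have -> : (c <= t < c + s) = false.
  apply/negbTE/negP => /andP[? ?]; move: st; rewrite ltr_normr; lra.
by rewrite !mul0r subr0 mul0r addr0.
Qed.

Lemma hat_supp c s t : s < `|t - c| -> hat c s t = 0.
Proof. by case/hat_dhat_supp. Qed.

Lemma dhat_supp c s t : s < `|t - c| -> dhat c s t = 0.
Proof. by case/hat_dhat_supp. Qed.

(** Equality holds on the support, and the left side is nonpositive off it. The bound makes hats of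
    growing width tend to 1 at each point. *)
Lemma hat_near1 s t : 0 < s -> 1 - `|t| / s <= hat 0 s t.
Proof.
move=> s0; rewrite /hat !indic_itvco sub0r add0r subr0.
have [t0|t0] := ltP t 0.
  rewrite andbT /= mul0r addr0 ltr0_norm//.
  have [st|st] := leP (- s) t; rewrite ?mul1r ?mul0r.
    by rewrite mulrDl divff ?gt_eqF// mulNr opprK addrC.
  by rewrite subr_le0 ler_pdivlMr// mul1r; lra.
rewrite andbF /= mul0r add0r ger0_norm//.
have [st|st] := ltP t s; rewrite ?mul1r ?mul0r.
  by rewrite mulrBl divff ?gt_eqF.
by rewrite subr_le0 ler_pdivlMr// mul1r; lra.
Qed.

Let itv_scale c s t a b : 0 < s ->
  (c + a * s <= t < c + b * s) = (a <= (t - c) / s < b).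
Proof.
by move=> s0; rewrite ler_pdivlMr// ltr_pdivrMr// lerBrDl ltrBlDl.
Qed.

Let hat_scale c s t : 0 < s -> hat c s t = hat 0 1 ((t - c) / s).
Proof.
move=> s0; have := itv_scale c t (-1) 0 s0; have := itv_scale c t 0 1 s0.
rewrite mulN1r mul0r mul1r addr0 => e1 e2.
rewrite /hat !indic_itvco e1 e2 !sub0r !add0r !divr1 !subr0.
congr (_ * _ + _ * _); field; exact: lt0r_neq0.
Qed.

Let dhat_scale c s t : 0 < s -> dhat c s t = dhat 0 1 ((t - c) / s) / s.
Proof.
move=> s0; have := itv_scale c t (-1) 0 s0; have := itv_scale c t 0 1 s0.
rewrite mulN1r mul0r mul1r addr0 => e1 e2.
by rewrite /dhat !indic_itvco e1 e2 !sub0r !add0r !divr1.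
Qed.

Let refine_ctr_scale c s t (k : 'I_3) : 0 < s ->
  (t - refine_ctr c s k) / (s / 2) = 2 * ((t - c) / s) - (k%:R - 1).
Proof. by move=> s0; rewrite /refine_ctr; field; exact: lt0r_neq0. Qed.

Let sum3 (F : 'I_3 -> R) :
  \sum_(k < 3) F k = F 0 + F 1 + F (inord 2).
Proof.
rewrite !big_ord_recl big_ord0 addr0 addrA; congr (_ + F _ + F _);
  by apply/val_inj; rewrite //= inordK.
Qed.

Let inord2_neq1 : (inord 2 == 1 :> 'I_3) = false.
Proof. by rewrite -val_eqE /= inordK. Qed.

Ltac decide_ineqs := repeat match goal with
  | |- context [?a <= ?b :> R] =>
      first [rewrite (_ : a <= b = true); last by lra
            |rewrite (_ : a <= b = false); last by apply/negbTE; rewrite -ltNge; lra]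
  | |- context [?a < ?b :> R] =>
      first [rewrite (_ : a < b = true); last by lra
            |rewrite (_ : a < b = false); last by apply/negbTE; rewrite -leNgt; lra]
  end.

(** All indicators are constant between consecutive breakpoints -1, -1/2, 0, 1/2, 1, which leaves
    six affine cases. In the second identity the weights are doubled, since halving the scale
    doubles the slope. *)
Let hat_dhat_refine01 x :
  hat 0 1 x =
    2^-1 * hat 0 1 (2 * x + 1) + hat 0 1 (2 * x) + 2^-1 * hat 0 1 (2 * x - 1) /\
  dhat 0 1 x =
    dhat 0 1 (2 * x + 1) + 2 * dhat 0 1 (2 * x) + dhat 0 1 (2 * x - 1).
Proof.
rewrite /hat /dhat !indic_itvco !divr1 !sub0r !add0r.
have [?|?] := ltP x (-1); first by decide_ineqs => /=; lra.
have [?|?] := ltP x (-2^-1); first by decide_ineqs => /=; lra.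
have [?|?] := ltP x 0; first by decide_ineqs => /=; lra.
have [?|?] := ltP x (2^-1); first by decide_ineqs => /=; lra.
have [?|?] := ltP x 1; first by decide_ineqs => /=; lra.
by decide_ineqs => /=; lra.
Qed.

Lemma hat_refine c s t : 0 < s ->
  hat c s t = \sum_(k < 3) refine_wt k * hat (refine_ctr c s k) (s / 2) t.
Proof.
move=> s0; have s20 : 0 < s / 2 by rewrite divr_gt0.
under eq_bigr do rewrite hat_scale// refine_ctr_scale//.
rewrite sum3 /refine_wt /= hat_scale// (hat_dhat_refine01 _).1 inordK//.
rewrite sub0r opprK subrr subr0 mul1r inord2_neq1.
by rewrite (_ : 2%:R - 1 = 1 :> R) //; ring.
Qed.

Lemma dhat_refine c s t : 0 < s ->
  dhat c s t = \sum_(k < 3) refine_wt k * dhat (refine_ctr c s k) (s / 2) t.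
Proof.
move=> s0; have s20 : 0 < s / 2 by rewrite divr_gt0.
under eq_bigr do rewrite dhat_scale// refine_ctr_scale//.
rewrite sum3 /refine_wt /= dhat_scale// (hat_dhat_refine01 _).2 inordK//.
rewrite sub0r opprK subrr subr0 mul1r inord2_neq1.
rewrite (_ : 2%:R - 1 = 1 :> R); last by ring.
by field; exact: lt0r_neq0.
Qed.

Lemma refine_wt_gt0 k : 0 < refine_wt k.
Proof. by rewrite /refine_wt; case: ifP => // _; rewrite invr_gt0. Qed.

Lemma refine_ctr_dist c s k : 0 < s -> `|refine_ctr c s k - c| <= s / 2.
Proof.
move=> s0; rewrite /refine_ctr addrAC subrr add0r normrM (gtr0_norm (x := s / 2)).
  rewrite ler_piMl ?divr_ge0 ?(ltW s0)//.
  by case: k => -[|[|[|]]]//= _; rewrite ler_norml; apply/andP; split; lra.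
by rewrite divr_gt0.
Qed.

End hat.

(** * Coordinates and product integrals *)

Section tensor.
Context {R : realType}.

Section product.
Context d1 d2 (T1 : measurableType d1) (T2 : measurableType d2).
Variables (m1 : {sigma_finite_measure set T1 -> \bar R})
          (m2 : {sigma_finite_measure set T2 -> \bar R}).
Variables (f : T1 -> R) (g : T2 -> R).
Hypotheses (intf : m1.-integrable setT (EFin \o f))
           (intg : m2.-integrable setT (EFin \o g)).

Lemma integrable_tensor :
  (m1 \x m2)%E.-integrable setT (EFin \o (fun z => f z.1 * g z.2)).
Proof.
have mf : measurable_fun setT f by apply/measurable_EFinP/(measurable_int _ intf).
have mg : measurable_fun setT g by apply/measurable_EFinP/(measurable_int _ intg).
apply/integrable12ltyP.
  apply/measurable_EFinP; apply: measurable_funM.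
    exact: measurableT_comp.
  exact: measurableT_comp.
under eq_integral => x _.
  under eq_integral => y _ do rewrite /= normrM EFinM.
  rewrite ge0_integralZl//; last first.
    by apply/measurable_EFinP; exact: measurableT_comp.
  over.
have [_ foo] := integrableP _ _ _ intf; have [_ goo] := integrableP _ _ _ intg.
rewrite ge0_integralZr//; last 2 first.
- by apply/measurable_EFinP; exact: measurableT_comp.
- by apply: integral_ge0.
apply: lte_mul_pinfty.
- exact: integral_ge0.
- by rewrite ge0_fin_numE//; exact: integral_ge0.
- exact: goo.
Qed.

Lemma Rintegral_tensor :
  \int[(m1 \x m2)%E]_z (f z.1 * g z.2) = (\int[m1]_x f x) * (\int[m2]_y g y).
Proof.
rewrite /Rintegral -(integral12_prod_meas1 integrable_tensor).
have FE x : fubini_F m2 (EFin \o (fun z => f z.1 * g z.2)) x =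
    ((f x)%:E * (fine (\int[m2]_y (g y)%:E))%:E)%E.
  rewrite fineK; last exact: integrable_fin_num.
  by rewrite /fubini_F -integralZl.
rewrite (eq_integral (fun x : T1 =>
  ((f x)%:E * (fine (\int[m2]_y (g y)%:E))%:E)%E) _ (fun x _ => FE x)).
by rewrite integralZr//= fineM//; exact: integrable_fin_num.
Qed.

End product.


Let leb : {sigma_finite_measure set (measurableTypeR R) -> \bar R} :=
  @lebesgue_measure R.

Lemma rV_cons0 n (p : measurableTypeR R * 'rV[R]_n) :
  (rV_cons p : 'rV_n.+1) ord0 ord0 = p.1.
Proof.
transitivity (rV_cons p ord0 (lshift n ord0)).
  by congr (rV_cons p _ _); exact/val_inj.
by rewrite /rV_cons row_mxEl mxE mulr1n.
Qed.

Lemma rV_consS n (p : measurableTypeR R * 'rV[R]_n) i :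
  (rV_cons p : 'rV_n.+1) ord0 (lift ord0 i) = p.2 ord0 i.
Proof.
transitivity (rV_cons p ord0 (rshift 1 i)).
  by congr (rV_cons p _ _); exact/val_inj.
by rewrite /rV_cons row_mxEr.
Qed.

(** Induction on [n]: [lebesgue_rV n.+1] is the image of a product measure under [rV_cons], so the
    integral transfers to that product and the first coordinate splits off. *)
Lemma integrable_Rintegral_prod_rV n (F : 'I_n -> R -> R) :
  (forall i, leb.-integrable setT (EFin \o F i)) ->
  (lebesgue_rV n).-integrable setT
    (EFin \o (fun x : 'rV[R]_n => \prod_(i < n) F i (x ord0 i))) /\
  \int[lebesgue_rV n]_x (\prod_(i < n) F i (x ord0 i)) =
    \prod_(i < n) \int[leb]_t F i t.
Proof.
elim: n F => [|n IHn] F intF.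
  have -> : (fun x : 'rV[R]_0 => \prod_(i < 0) F i (x ord0 i)) = cst 1.
    by apply/funext => x; rewrite big_ord0.
  split.
    apply/integrableP; split; first exact/measurable_EFinP.
    by rewrite /= integral_dirac//= diracT mul1e normr1 ltry.
  by rewrite /Rintegral /= integral_dirac//= indicT mul1r big_ord0.
have [intG eqG] := IHn (fun i => F (lift ord0 i)) (fun i => intF _).
have prodE : (fun x : 'rV[R]_n.+1 => \prod_(i < n.+1) F i (x ord0 i)) \o @rV_cons R n =
    fun p => F ord0 p.1 * \prod_(i < n) F (lift ord0 i) (p.2 ord0 i).
  apply/funext => p /=; rewrite big_ord_recl rV_cons0; congr (_ * _).
  by apply: eq_bigr => i _; rewrite rV_consS.
have mF : measurable_fun setT (EFin \o (fun x : 'rV[R]_n.+1 =>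
    \prod_(i < n.+1) F i (x ord0 i))).
  apply/measurable_EFinP; apply: measurable_prod => i _.
  have mFi : measurable_fun [set: measurableTypeR R] (F i).
    by apply/measurable_EFinP; exact: measurable_int (intF i).
  apply: (measurableT_comp mFi); exact: measurable_rV_coord.
have := integrable_tensor (intF ord0) intG.
have := Rintegral_tensor (intF ord0) intG.
rewrite -prodE => eqP intP.
split.
  by apply: (integrable_pushforward (@measurable_rV_cons R n) mF).
rewrite big_ord_recl -eqG -eqP /Rintegral; congr fine.
by apply: (integral_pushforward (@measurable_rV_cons R n) mF).
Qed.

End tensor.

Section coordinates.
Context {R : realType} {d : nat}.
Local Notation T := ('rV[R]_d * 'rV[R]_d)%type.
Local Notation I := ('I_d + 'I_d)%type.
Let leb : {sigma_finite_measure set (measurableTypeR R) -> \bar R} :=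
  @lebesgue_measure R.

(** Positions and velocities are indexed together by ['I_d + 'I_d], so that sums and products over
    all axes run over a single finite type. *)
Definition coord (i : I) (x : T) : R :=
  match i with inl k => x.1 ord0 k | inr k => x.2 ord0 k end.

Definition coord_vec (i : I) : T :=
  match i with
  | inl k => (delta_mx ord0 k, 0)
  | inr k => (0, delta_mx ord0 k)
  end.

Definition of_coord (g : I -> R) : T :=
  (\row_k g (inl k), \row_k g (inr k)).

Lemma of_coordK g i : coord i (of_coord g) = g i.
Proof. by case: i => k; rewrite /= mxE. Qed.

Lemma measurable_coord i : measurable_fun setT (coord i).
Proof.
have mk k := @measurable_rV_coord _ (measurableTypeR R) d k.
case: i => k; first exact: (measurableT_comp (mk k) measurable_fst).
exact: (measurableT_comp (mk k) measurable_snd).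
Qed.

Lemma integrable_Rintegral_prod_coord (F : I -> R -> R) :
  (forall i, leb.-integrable setT (EFin \o F i)) ->
  lebesgue_T.-integrable setT (EFin \o (fun x => \prod_i F i (coord i x))) /\
  \int[lebesgue_T]_x (\prod_i F i (coord i x)) = \prod_i \int[leb]_t F i t.
Proof.
move=> intF.
have [i1 e1] := integrable_Rintegral_prod_rV (fun i : 'I_d => intF (inl i)).
have [i2 e2] := integrable_Rintegral_prod_rV (fun i : 'I_d => intF (inr i)).
under [in X in X /\ _]eq_fun do rewrite big_sumType.
under [in X in _ /\ X]eq_fun do rewrite big_sumType.
rewrite big_sumType -e1 -e2; split; first exact: (integrable_tensor i1 i2).
exact: (Rintegral_tensor i1 i2).
Qed.

End coordinates.

(** * Tensor products of hat functions *)

Section bump.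
Context {R : realType} {d : nat}.
Local Notation T := ('rV[R]_d * 'rV[R]_d)%type.
Local Notation I := ('I_d + 'I_d)%type.
Local Notation leb := (@lebesgue_measure R).
Implicit Types (c x : T) (s : R) (i j l : I).

Definition bump c s x : R := \prod_i hat (coord i c) s (coord i x).

(** The partial derivative of [bump] along axis [i], with [dhat] standing for the derivative of
    [hat] at the kinks as well. *)
Definition dbump i c s x : R :=
  \prod_j (if j == i then dhat else hat) (coord j c) s (coord j x).

Lemma bump_ge0 c s x : 0 < s -> 0 <= bump c s x.
Proof. by move=> s0; apply: prodr_ge0 => i _; exact: hat_ge0. Qed.

Lemma bump_le1 c s x : 0 < s -> bump c s x <= 1.
Proof.
by move=> s0; apply: prodr_ile1 => i _; rewrite hat_ge0//= hat_le1.
Qed.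

Lemma bump_supp c s x i : s < `|coord i x - coord i c| -> bump c s x = 0.
Proof. by move=> sx; rewrite /bump (bigD1 i)//= hat_supp// mul0r. Qed.

Lemma dbump_supp j c s x i :
  s < `|coord i x - coord i c| -> dbump j c s x = 0.
Proof.
move=> sx; rewrite /dbump (bigD1 i)//=; case: ifP => _.
  by rewrite dhat_supp// mul0r.
by rewrite hat_supp// mul0r.
Qed.

Lemma norm_dbump_le i c s x : 0 < s -> `|dbump i c s x| <= s^-1.
Proof.
move=> s0; rewrite /dbump (bigD1 i)//= eqxx normrM normr_prod.
rewrite (le_trans _ (norm_dhat_le (coord i c) (coord i x) s0))// ler_piMr//.
apply: prodr_ile1 => j /negbTE ->; rewrite normr_ge0 ger0_norm ?hat_le1//.
exact: hat_ge0.
Qed.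

Let measurable_comp_coord (f : R -> R) i :
  measurable_fun [set: measurableTypeR R] f ->
  measurable_fun setT (fun x : T => f (coord i x)).
Proof. by move=> mf; exact: (measurableT_comp mf (measurable_coord i)). Qed.

Lemma measurable_bump c s : measurable_fun setT (bump c s).
Proof.
apply: measurable_prod => i _; apply: measurable_comp_coord.
exact: measurable_hat.
Qed.

Lemma measurable_dbump i c s : measurable_fun setT (dbump i c s).
Proof.
apply: measurable_prod => j _; apply: measurable_comp_coord.
by case: ifP => _; [exact: measurable_dhat|exact: measurable_hat].
Qed.

Section integrals.
Variables (c : T) (s : R).
Hypothesis s_gt0 : 0 < s.

Lemma integrable_bump : lebesgue_T.-integrable setT (EFin \o bump c s).
Proof.
have [//|+ _] := integrable_Rintegral_prod_coord
  (F := fun i => hat (coord i c) s) => [i|].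
  exact: integrable_hat.
by [].
Qed.

Lemma Rintegral_bump : \int[lebesgue_T]_x bump c s x = s ^+ #|{: I}|.
Proof.
have [|_ ->] := integrable_Rintegral_prod_coord
  (F := fun i => hat (coord i c) s) => [i|].
  exact: integrable_hat.
under eq_bigr do rewrite Rintegral_hat//.
by rewrite prodr_const.
Qed.

Let integrable_dfactor i j : leb.-integrable setT
  (EFin \o ((if j == i then dhat else hat) (coord j c) s)).
Proof. by case: ifP => _; [exact: integrable_dhat|exact: integrable_hat]. Qed.

Lemma integrable_dbump i : lebesgue_T.-integrable setT (EFin \o dbump i c s).
Proof. exact: (integrable_Rintegral_prod_coord (integrable_dfactor i)).1. Qed.

Lemma Rintegral_dbump i : \int[lebesgue_T]_x dbump i c s x = 0.
Proof.
rewrite (integrable_Rintegral_prod_coord (integrable_dfactor i)).2.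
by rewrite (bigD1 i)//= eqxx Rintegral_dhat// mul0r.
Qed.

(** Factor [i] contributes 2 and every other factor [s]; multiplying by [s] avoids the exponent
    [#|{: I}| - 1]. *)
Lemma Rintegral_norm_dbump i :
  s * \int[lebesgue_T]_x `|dbump i c s x| = 2 * s ^+ #|{: I}|.
Proof.
pose F j (t : R) := `|(if j == i then dhat else hat) (coord j c) s t|.
have intF j : leb.-integrable setT (EFin \o F j).
  exact: integrable_norm (integrable_dfactor i j).
transitivity (s * \int[lebesgue_T]_x \prod_j F j (coord j x)).
  by congr (_ * _); apply: eq_Rintegral => x _; rewrite /dbump normr_prod.
rewrite (integrable_Rintegral_prod_coord intF).2 /F.
rewrite (bigD1 i)//= eqxx Rintegral_norm_dhat// mulrCA; congr (_ * _).
rewrite -[RHS](prodr_const {: I}) [RHS](bigD1 i)//=; congr (_ * _).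
apply: eq_bigr => j /negbTE ->.
rewrite -[RHS](@Rintegral_hat _ (coord j c) s)//; apply: eq_Rintegral => t _.
by rewrite ger0_norm// hat_ge0.
Qed.

(** The weight [coord j x - coord j c] is absorbed into the factor of index [j], which keeps the
    integrand a product of functions of one coordinate. *)
Let xfactor i j l (t : R) : R :=
  (if l == j then t - coord l c else 1) *
  (if l == i then dhat else hat) (coord l c) s t.

Let integrable_xfactor i j l : leb.-integrable setT (EFin \o xfactor i j l).
Proof.
rewrite /xfactor; have [_|_] := eqVneq l j; last first.
  under [X in _.-integrable _ (_ \o X)]eq_fun do rewrite mul1r.
  exact: integrable_dfactor.
have [_|_] := eqVneq l i; first exact: integrable_xdhat.
apply: (@le_integrable _ (measurableTypeR R) R leb setT measurableT _
  (fun t => s%:E * (EFin \o hat (coord l c) s) t)%E).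
- apply/measurable_EFinP; apply: measurable_funM; last exact: measurable_hat.
  exact: measurable_funB.
- move=> t _ /=; rewrite lee_fin !normrM.
  have [ts|ts] := leP `|t - coord l c| s.
    by rewrite ler_wpM2r// (le_trans ts)// ler_norm.
  by rewrite hat_supp// normr0 !mulr0.
- by apply: integrableZl => //; exact: integrable_hat.
Qed.

Let xfactorE i j : (fun x => (coord j x - coord j c) * dbump i c s x) =
  fun x => \prod_l xfactor i j l (coord l x).
Proof.
apply/funext => x; rewrite /xfactor big_split /=; congr (_ * _).
by rewrite -big_mkcond/= big_pred1_eq.
Qed.

Lemma integrable_xdbump i j : lebesgue_T.-integrable setT
  (EFin \o (fun x => (coord j x - coord j c) * dbump i c s x)).
Proof.
by rewrite xfactorE; exact: (integrable_Rintegral_prod_coord (integrable_xfactor i j)).1.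
Qed.

(** For [j != i] the factor [i] integrates to 0; for [j = i] it is the first moment of [dhat]. With
    [Rintegral_dbump], this is integration by parts of affine functions against [bump]. *)
Lemma Rintegral_xdbump i j :
  \int[lebesgue_T]_x ((coord j x - coord j c) * dbump i c s x) =
  - (j == i)%:R * s ^+ #|{: I}|.
Proof.
rewrite xfactorE (integrable_Rintegral_prod_coord (integrable_xfactor i j)).2.
rewrite (bigD1 i)//= {1}/xfactor eqxx.
have [->|ji] := eqVneq j i; last first.
  under eq_Rintegral do rewrite mul1r.
  by rewrite Rintegral_dhat// oppr0 !mul0r.
rewrite Rintegral_xdhat// !mulNr mul1r; congr (- _).
rewrite -[RHS](prodr_const {: I}) [RHS](bigD1 i)//=; congr (_ * _).
apply: eq_bigr => l /negbTE li; rewrite /xfactor li.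
under eq_Rintegral do rewrite mul1r.
by rewrite Rintegral_hat.
Qed.

End integrals.

Definition refine_vec c s (k : {ffun I -> 'I_3}) : T :=
  of_coord (fun i => refine_ctr (coord i c) s (k i)).

Definition refine_coef (k : {ffun I -> 'I_3}) : R := \prod_i refine_wt (k i).

Lemma refine_coef_gt0 k : 0 < refine_coef k.
Proof. by apply: prodr_gt0 => i _; exact: refine_wt_gt0. Qed.

Lemma refine_vec_dist c s k i : 0 < s ->
  `|coord i (refine_vec c s k) - coord i c| <= s / 2.
Proof. by rewrite of_coordK; exact: refine_ctr_dist. Qed.

(** Expanding the product of the one-dimensional relations gives one term for each choice of a child
    along every axis. *)
Lemma bump_refine c s x : 0 < s ->
  bump c s x = \sum_k refine_coef k * bump (refine_vec c s k) (s / 2) x.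
Proof.
move=> s0; rewrite /bump; under eq_bigr do rewrite hat_refine//.
rewrite bigA_distr_bigA; apply: eq_bigr => k _.
by rewrite big_split; congr (_ * _); apply: eq_bigr => i _; rewrite of_coordK.
Qed.

Lemma dbump_refine i c s x : 0 < s ->
  dbump i c s x = \sum_k refine_coef k * dbump i (refine_vec c s k) (s / 2) x.
Proof.
move=> s0; rewrite /dbump.
under eq_bigr => j _.
  rewrite (_ : (if j == i then dhat else hat) (coord j c) s (coord j x) =
    \sum_(k < 3) refine_wt k *
      (if j == i then dhat else hat) (refine_ctr (coord j c) s k) (s / 2) (coord j x));
    last by case: ifP => _; [exact: dhat_refine|exact: hat_refine].
  over.
rewrite bigA_distr_bigA; apply: eq_bigr => k _.
by rewrite big_split; congr (_ * _); apply: eq_bigr => j _; rewrite of_coordK.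
Qed.

End bump.

(** * Measurability and regularity *)

Section topology.
Context {R : realType} {d : nat}.
Local Notation T := ('rV[R]_d * 'rV[R]_d)%type.
Local Notation I := ('I_d + 'I_d)%type.

Lemma nbhs_coordP (x : T) (U : set T) : nbhs x U <->
  exists2 r : R, 0 < r &
    forall y, (forall i, `|coord i y - coord i x| < r) -> U y.
Proof.
split=> [/nbhs_ballP[r /= r0 xU]|[r r0 xU]].
  exists r => // y xy; apply: xU; split; split=> // i j; rewrite !ord1.
    by have := xy (inl j); rewrite distrC.
  by have := xy (inr j); rewrite distrC.
apply/nbhs_ballP; exists r => //= y [[_ xy1] [_ xy2]]; apply: xU => -[] j.
  by have := xy1 ord0 j; rewrite /ball /= distrC.
by have := xy2 ord0 j; rewrite /ball /= distrC.
Qed.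

Lemma continuous_coord i : continuous (coord i : T -> R).
Proof.
move=> x A /nbhs_ballP[r /= r0 xA]; apply/nbhs_coordP; exists r => // y xy.
by apply: xA; rewrite /ball /= distrC.
Qed.

Lemma open_ltr_coord i (a : R) : open [set x : T | a < coord i x].
Proof.
by apply: (open_comp (f := coord i) (D := [set t : R | a < t]))
  => [x _|]; [exact: continuous_coord|exact: open_gt].
Qed.

Lemma closed_ler_coord i (a : R) : closed [set x : T | a <= coord i x].
Proof.
by apply: (closed_comp (f := coord i) (D := [set t : R | a <= t]))
  => [x _|]; [exact: continuous_coord|exact: closed_ge].
Qed.

(** The measurable sets are generated by the coordinates, so an open set is written as the union of
    the countably many rational boxes that it contains. *)
Lemma open_measurable_rV2 (U : set T) : open U -> measurable U.
Proof.
move=> oU.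
pose box (p : {ffun I -> rat} * rat) : set T := if p.2 <= 0 then set0 else
  [set x | forall i, `|coord i x - ratr (p.1 i)| < ratr p.2].
pose V p : set T := if `[< box p `<=` U >] then box p else set0.
have -> : U = \bigcup_p V p.
  apply/seteqP; split=> [x Ux|x [p _]]; last first.
    by rewrite /V; case: ifPn => // /asboolP; exact.
  have /nbhs_coordP[r r0 xU] : nbhs x U by exact: open_nbhs_nbhs.
  (* With its centre within [q] of [x] and [q < r / 2], a box of radius [q] contains [x] and stays
     in the cube of radius [r] around [x]. *)
  have [q qr] : exists q : rat, ratr q \in `]0 : R, r / 2[.
    by apply: rat_in_itvoo; rewrite divr_gt0.
  move: qr; rewrite in_itv /= => /andP[q0 qr].
  have /choice[f fx] : forall i, exists p : rat, ratr p \in `]coord i x, coord i x + ratr q[.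
    by move=> i; apply: rat_in_itvoo; rewrite ltrDl.
  exists ([ffun i => f i], q) => //; rewrite /V.
  have qq : q <= 0 = false by apply/negbTE; rewrite -ltNge -(ltr0q R).
  have fxq i : `|coord i x - ratr (f i)| < ratr q.
    by have := fx i; rewrite in_itv /= => /andP[? ?]; rewrite ltr_norml; lra.
  case: ifPn => [_|/asboolP[]].
    by rewrite /box /= qq => i; rewrite ffunE.
  rewrite /box /= qq => y /= yq; apply: xU => i.
  have := yq i; rewrite ffunE; have := fxq i; rewrite !ltr_norml; lra.
apply: countable_bigcupT_measurable => [|p]; first exact: countableP.
rewrite /V; case: ifP => // _; rewrite /box; case: ifP => // _.
rewrite (_ : [set x | _] = \bigcap_(i in [set: I])
  ((fun x : T => `|coord i x - ratr (p.1 i)|) @^-1` `]-oo, ratr p.2[%classic)).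
  apply: fin_bigcap_measurable => // i _.
  rewrite -[X in measurable X]setTI.
  have : measurable_fun setT (fun x : T => `|coord i x - ratr (p.1 i)|).
    apply: measurableT_comp => //; apply: measurable_funB => //.
    exact: measurable_coord.
  by apply => //; exact: measurable_itv.
apply/seteqP; split=> x /= xp i; first by move=> _; rewrite /= in_itv /=; exact: xp.
by have := xp i Logic.I; rewrite /= in_itv.
Qed.

Lemma continuous_measurable_rV2 (f : T -> R) :
  continuous f -> measurable_fun setT f.
Proof.
move=> cf; apply: (measurability _ (RGenOInfty.measurableE R)).
move=> _ [_ [a ->] <-]; rewrite setTI; apply: open_measurable_rV2.
by apply: open_comp => [x _|]; [exact: cf|exact: rray_open].
Qed.

End topology.

Section regularity.
Context {R : realType} {d : nat}.
Local Notation T := ('rV[R]_d * 'rV[R]_d)%type.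
Local Notation I := ('I_d + 'I_d)%type.

Section finite_measure.
Variable nu : {finite_measure set T -> \bar R}.

(** Approximation from inside by closed and from outside by open sets. Such sets form a
    sigma-algebra containing the coordinate half-spaces, which generate the measurable sets. *)
Let regular : set (set T) := [set A | forall e : R, 0 < e ->
  exists F U, [/\ closed F, open U, F `<=` A, A `<=` U & (nu (U `\` F) < e%:E)%E]].

Let closed_measurable (F : set T) : closed F -> measurable F.
Proof.
move=> cF; rewrite -[F]setCK; apply: measurableC; apply: open_measurable_rV2.
exact: closed_openC.
Qed.

Let finite_nu (A : set T) : measurable A -> (nu A < +oo)%E.
Proof. by move=> mA; rewrite ltey_eq fin_num_measure. Qed.

(** Continuity of the finite measure [nu] along a decreasing sequence; [D] only has to contain the
    intersection. *)
Let shrinking (G : (set T)^nat) (D : set T) (e : R) :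
  (forall n, measurable (G n)) -> measurable D ->
  {homo G : n m / (n <= m)%N >-> (m <= n)%O} ->
  \bigcap_n G n `<=` D -> (nu D < e%:E)%E -> exists n, (nu (G n) < e%:E)%E.
Proof.
move=> mG mD ndG GD nuD.
have mcap : measurable (\bigcap_n G n) by exact: bigcap_measurable.
have : (nu \o G) x @[x --> \oo] --> nu (\bigcap_n G n).
  exact: nonincreasing_cvg_mu (finite_nu (mG 0%N)) mG mcap ndG.
have lt_e : (nu (\bigcap_n G n) < e%:E)%E.
  by apply: le_lt_trans nuD; apply: le_measure; rewrite ?inE.
have : nbhs (nu (\bigcap_n G n)) [set y | (y < e%:E)%E].
  by apply: open_nbhs_nbhs; split => //; exact: open_ereal_lt_ereal.
by move=> + H => /H[n _ /(_ n (leqnn n))]; exists n.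
Qed.

Let sigma_algebra_regular : sigma_algebra setT regular.
Proof.
split.
- move=> e e0; exists set0, set0; split => //; last first.
  + by rewrite setD0 measure0 lte_fin.
  + exact: closed0.
- move=> A rA e e0; have [F [U [cF oU FA AU FU]]] := rA e e0.
  exists (~` U), (~` F); split.
  + exact: open_closedC.
  + exact: closed_openC.
  + by rewrite setTD; exact: subsetC.
  + by rewrite setTD; exact: subsetC.
  + by rewrite setDE setCK setIC -setDE.
- move=> A rA e e0.
  have e4 k : 0 < e / 2 / (2 ^ k.+1)%:R :> R by rewrite !divr_gt0// ltr0n expn_gt0.
  have /choice[F /choice[U FU]] : forall k, exists F U, [/\ closed F, open U,
      F `<=` A k, A k `<=` U & (nu (U `\` F) < (e / 2 / (2 ^ k.+1)%:R)%:E)%E].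
    by move=> k; exact: rA k _ (e4 k).
  have oU k : open (U k) by have [] := FU k.
  have cF k : closed (F k) by have [] := FU k.
  have mU k : measurable (U k) by exact: open_measurable_rV2.
  have mF k : measurable (F k) by exact: closed_measurable.
  (* An infinite union of closed sets need not be closed, so only the first [n] sets [F k] are kept.
     The defect [G n] decreases into the union of the differences of [U k] and [F k], of measure at
     most [e / 2]. *)
  pose G n := \bigcup_k U k `\` \big[setU/set0]_(k < n) F k.
  have mG n : measurable (G n).
    apply: measurableD; first exact: bigcup_measurable.
    exact: bigsetU_measurable.
  have [n Gn] : exists n, (nu (G n) < e%:E)%E.
    apply: (shrinking (D := \bigcup_k (U k `\` F k))) => //.
    + by apply: bigcup_measurable => k _; exact: measurableD.
    + move=> n m nm; rewrite subsetEset; apply: setDS.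
      exact: (subset_bigsetU nm).
    + move=> x Gx; have [k _ Ux] : (\bigcup_k U k) x by have [] := Gx 0%N Logic.I.
      exists k => //; split => // Fx; have [_] := Gx k.+1 Logic.I; apply.
      by rewrite -bigcup_mkord; exists k => //=.
    + apply: (@le_lt_trans _ _ (e / 2)%:E); last by rewrite lte_fin; lra.
      apply: (@le_trans _ _ (\sum_(k <oo) (0 + (e / 2 / (2 ^ k.+1)%:R)%:E)))%E.
        apply: le_trans (measure_sigma_subadditive _ _ _ (@subset_refl _ _)) _.
        * by move=> k; exact: measurableD.
        * by apply: bigcup_measurable => k _; exact: measurableD.
        * by apply: lee_nneseries => // k _; rewrite add0e; apply/ltW; have [] := FU k.
      apply: le_trans (epsilon_trick _ _ _) _ => //; first by rewrite divr_ge0// ltW.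
      by rewrite eseries0// add0e.
  exists (\big[setU/set0]_(k < n) F k), (\bigcup_k U k); split => //.
  + by apply: closed_bigsetU => k _; exact: cF.
  + by apply: bigcup_open => k _; exact: oU.
  + rewrite -bigcup_mkord => x [k /= kn Fx]; exists k => //.
    by have [_ _ + _ _] := FU k; apply.
  + by move=> x [k _ Ax]; exists k => //; have [_ _ _ + _] := FU k; apply.
Qed.

Let regular_gtr_coord i (a : R) : regular [set x : T | a < coord i x].
Proof.
move=> e e0.
pose F n : set T := [set x | a + n.+1%:R^-1 <= coord i x].
have cF n : closed (F n) by exact: closed_ler_coord.
have oU : open [set x : T | a < coord i x] by exact: open_ltr_coord.
have [n Fn] : exists n, (nu ([set x : T | (a < coord i x)%R] `\` F n) < e%:E)%E.
  apply: (shrinking (D := set0)) => //.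
  - move=> n; apply: measurableD; first exact: open_measurable_rV2.
    exact: closed_measurable.
  - move=> n m nm; rewrite subsetEset; apply: setDS => x; rewrite /F /=.
    apply: le_trans; rewrite lerD2l lef_pV2 ?posrE ?ltr0n//.
    by rewrite ler_nat.
  - move=> x Gx; have [/= ax _] := Gx 0%N Logic.I.
    have := Gx (Num.truncn (coord i x - a)^-1) Logic.I.
    move=> [_]; apply; rewrite /F /= -lerBrDl invf_ple ?posrE ?ltr0n ?subr_gt0//.
    by apply/ltW/truncnS_gt.
  - by rewrite measure0 lte_fin.
exists (F n), [set x : T | a < coord i x]; split => //.
by move=> x; rewrite /F /=; apply: lt_le_trans; rewrite ltrDl invr_gt0 ltr0n.
Qed.

Lemma finite_measure_regular (A : set T) : measurable A -> regular A.
Proof.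
pose T' := g_sigma_algebraType regular.
(* Measurability of the identity from the sigma-algebra of regular sets reduces to that of the
   coordinates. *)
suff mid : measurable_fun [set: T'] (idfun : T' -> T).
  move=> mA; have := mid measurableT A mA.
  by rewrite setTI preimage_id measurable_g_measurableTypeE.
have mc i : measurable_fun [set: T'] (coord i : T' -> R).
  apply: (measurability _ (RGenOInfty.measurableE R)).
  move=> _ [_ [a ->] <-]; rewrite setTI; apply: sub_sigma_algebra.
  by rewrite set_itvoy; exact: regular_gtr_coord.
have m1 : measurable_fun [set: T'] (fst : T' -> 'rV[R]_d).
  by apply: (@measurable_fun_rVP _ _ T' (measurableTypeR R)) => k; exact: (mc (inl k)).
have m2 : measurable_fun [set: T'] (snd : T' -> 'rV[R]_d).
  by apply: (@measurable_fun_rVP _ _ T' (measurableTypeR R)) => k; exact: (mc (inr k)).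
by apply/measurable_fun_pairP; split.
Qed.

End finite_measure.
End regularity.

(** * Majorants near every point that are close in mean *)

Section majorant.
Context {R : realType} {d : nat}.
Local Notation T := ('rV[R]_d * 'rV[R]_d)%type.
Local Notation mu := (@lebesgue_T R d).
Variables (B : set T) (phi f : T -> R).
Hypotheses (mB : measurable B) (muB : (mu B < +oo)%E)
  (mphi : measurable_fun setT phi) (phi_ge0 : forall x, 0 <= phi x)
  (phi_le1 : forall x, phi x <= 1) (phi_supp : forall x, ~ B x -> phi x = 0)
  (mf : measurable_fun setT f) (f_ge0 : forall x, 0 <= f x).

(** The sum is [t] times the number of levels [k%:R * t <= u] with [k < n]; level 0 accounts for the
    excess [t]. The bound [n%:R * t] carries the induction. *)
Let sum_levels_le (t u : R) n : 0 < t -> 0 <= u ->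
  \sum_(0 <= k < n) t * (k%:R * t <= u)%R%:R <= Num.min (n%:R * t) (u + t).
Proof.
move=> t0 u0; elim: n => [|n IHn].
  by rewrite big_nil mul0r le_min lexx addr_ge0// ltW.
rewrite big_nat_recr//=; have [tu|tu] := leP (n%:R * t) u.
  rewrite mulr1 -natr1 mulrDl mul1r le_min.
  move: IHn; rewrite le_min => /andP[IH1 IH2]; apply/andP; split; first by rewrite lerD2r.
  by lra.
rewrite mulr0 addr0 (le_trans IHn)// le_min; apply/andP; split.
  by rewrite ge_min ler_wpM2r ?ler_nat// ltW.
by rewrite ge_min lexx orbT.
Qed.

(* A form of the Vitali-Caratheodory theorem. The integrals are weighted by
   [phi] so that only the measure of [B] has to be finite. *)
Lemma locally_majorizing (e : R) : 0 < e ->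
  exists w : T -> \bar R, [/\ measurable_fun setT w, forall x, (0 <= w x)%E,
    forall x, \forall y \near x, ((f x)%:E <= w y)%E &
    (\int[mu]_x (w x * (phi x)%:E) <= \int[mu]_x (f x * phi x)%:E + e%:E)%E].
Proof.
move=> e0; pose K := fine (mu B).
have K0 : 0 <= K by rewrite fine_ge0.
(* The error is at most [t] from enlarging the level sets to open sets plus [t * K] from rounding
   [f] to multiples of [t]. *)
have [t t0 tK] : exists2 t : R, 0 < t & t * (K + 1) = e.
  exists (e / (K + 1)); first by rewrite divr_gt0// ltr_wpDl.
  by rewrite divfK// gt_eqF// ltr_wpDl.
pose A k : set T := [set x | k%:R * t <= f x].
have mA k : measurable (A k).
  rewrite -[A k]setTI (_ : A k = f @^-1` `[k%:R * t, +oo[%classic).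
    exact: mf.
  by apply/seteqP; split=> x; rewrite /A /= in_itv/= andbT.
pose nu : {finite_measure set T -> \bar R} := mfrestr mB muB.
have nuE (C : set T) : nu C = mu (C `&` B) by [].
have p0 k : 0 < 1 / (2 ^ k.+1)%:R :> R by rewrite divr_gt0// ltr0n expn_gt0.
(* Inside [B], [U k] exceeds the level set [A k] by at most the inverse of [2 ^ k.+1]; multiplied by
   [t], these excesses sum to [t]. *)
have /choice[U AU] : forall k, exists U, [/\ open U, A k `<=` U &
    (nu (U `\` A k) <= (1 / (2 ^ k.+1)%:R)%:E)%E].
  move=> k; have [F [U [cF oU FA AU FU]]] := finite_measure_regular nu (mA k) (p0 k).
  exists U; split => //; apply: le_trans (ltW FU).
  have mF : measurable F.
    by rewrite -[F]setCK; apply: measurableC; apply: open_measurable_rV2; exact: closed_openC.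
  have mU := open_measurable_rV2 oU.
  by apply: le_measure; rewrite ?inE; [exact: measurableD|exact: measurableD|exact: setDS].
have oU k : open (U k) by have [] := AU k.
have mU k : measurable (U k) by exact: open_measurable_rV2.
have AsubU k : A k `<=` U k by have [] := AU k.
pose g (C : nat -> set T) k x : \bar R := (t * \1_(C k) x)%:E.
have g0 C k x : (0 <= g C k x)%E by rewrite lee_fin mulr_ge0// ltW.
have mg C k : measurable (C k) -> measurable_fun setT (g C k).
  by move=> mC; apply/measurable_EFinP; apply: measurable_funM.
pose gphi (C : nat -> set T) k x : \bar R := (t * \1_(C k) x * phi x)%:E.
have gphi0 C k x : (0 <= gphi C k x)%E.
  by rewrite lee_fin mulr_ge0// mulr_ge0// ltW.
have mgphi C k : measurable (C k) -> measurable_fun setT (gphi C k).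
  move=> mC; apply/measurable_EFinP; apply: measurable_funM => //.
  exact: measurable_funM.
have sumgphi C x : ((\sum_(k <oo) g C k x) * (phi x)%:E = \sum_(k <oo) gphi C k x)%E.
  rewrite muleC -nneseriesZl//; apply: eq_eseriesr => k _.
  by rewrite -EFinM /gphi mulrC.
exists (fun x => \sum_(k <oo) g U k x)%E; split.
- by apply: ge0_emeasurable_sum => k //= _; exact: mg.
- by move=> x; exact: nneseries_ge0.
(* [f x] reaches exactly the levels 0 to [n - 1], whose open sets all contain [x]. On a common
   neighbourhood the partial sum is [n%:R * t], at least [f x]. *)
- move=> x; pose n := (Num.truncn (f x / t)).+1.
  have nx : f x <= n%:R * t by rewrite -ler_pdivrMr// ltW// truncnS_gt.
  have Uk (k : 'I_n) : \forall y \near x, U k y.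
    apply: open_nbhs_nbhs; split => //; apply: AsubU.
    rewrite /A /= -ler_pdivlMr//.
    have /andP[+ _] := truncn_itv (divr_ge0 (f_ge0 x) (ltW t0)).
    by apply: le_trans; rewrite ler_nat -ltnS.
  apply: filterS (filter_forall _ Uk) => y Uy /=.
  apply: le_trans (nneseries_lim_ge n _) => //.
  rewrite (eq_big_nat _ _ (F2 := fun=> t%:E)); last first.
    move=> k /andP[_ kn]; rewrite /g indicE mem_set ?mulr1//.
    exact: (Uy (Ordinal kn)).
  rewrite sumEFin lee_fin (le_trans nx)// sumr_const_nat subn0 .
  by rewrite mulr_natl.
rewrite (eq_integral (fun x => \sum_(k <oo) gphi U k x)%E); last by move=> x _; exact: sumgphi.
rewrite integral_nneseries//; last by move=> k; exact: mgphi.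
have step k : (\int[mu]_x gphi U k x <=
    \int[mu]_x gphi A k x + (t / (2 ^ k.+1)%:R)%:E)%E.
  (* Off [B] the weight [phi] vanishes and on [B] it is at most 1, so passing from [A k] to [U k]
     costs at most [t] times the measure of [D]. *)
  pose D := (U k `\` A k) `&` B.
  have mD : measurable D by apply: measurableI => //; exact: measurableD.
  apply: (@le_trans _ _ (\int[mu]_x (gphi A k x + (t * \1_D x)%:E))%E).
    apply: ge0_le_integral => //.
    - exact: mgphi.
    - apply: emeasurable_funD; first exact: mgphi.
      by apply/measurable_EFinP; exact: measurable_funM.
    - move=> x _; rewrite /gphi -EFinD lee_fin -!mulrA -mulrDr ler_pM2l//.
      rewrite !indicE; have [Bx|nBx] := pselect (B x); last first.
        by rewrite phi_supp// !mulr0 add0r ler0n.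
      have [Ax|nAx] := pselect (A k x).
        by rewrite (mem_set Ax) (mem_set (AsubU _ _ Ax)) lerDl ler0n.
      have [Ux|nUx] := pselect (U k x).
        by rewrite (mem_set Ux) (memNset nAx) mem_set// mul0r add0r mul1r phi_le1.
      by rewrite (memNset nUx) mul0r addr_ge0// mulr_ge0.
  rewrite ge0_integralD//; last 3 first.
  - exact: mgphi.
  - by move=> x _; rewrite lee_fin mulr_ge0// ltW.
  - by apply/measurable_EFinP; exact: measurable_funM.
  rewrite leeD2l//; under eq_integral do rewrite EFinM.
  rewrite ge0_integralZl//; last 2 first.
  - by apply/measurable_EFinP.
  - by rewrite lee_fin ltW.
  rewrite integral_indic// setIT EFinM lee_pmul2l//; have [_ _] := AU k.
  by rewrite nuE div1r.
apply: le_trans (lee_nneseries _ (fun k _ => step k)) _ => //.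
  by move=> k _ _; exact: integral_ge0.
apply: le_trans (epsilon_trick _ _ (ltW t0)) _.
  by move=> k; exact: integral_ge0.
rewrite -integral_nneseries//; last by move=> k; exact: mgphi.
have mfphi : measurable_fun setT (fun x => (f x * phi x)%:E).
  by apply/measurable_EFinP; exact: measurable_funM.
have mtphi : measurable_fun setT (fun x => (t * phi x)%:E).
  by apply/measurable_EFinP; exact: measurable_funM.
(* By [sum_levels_le], the layers over the sets [A k] add up to at most [f + t]. *)
apply: (@le_trans _ _ (\int[mu]_x ((f x * phi x)%:E + (t * phi x)%:E) + t%:E)%E).
  rewrite leeD2r//; apply: ge0_le_integral => //.
  - by move=> x _; exact: nneseries_ge0.
  - by apply: ge0_emeasurable_sum => // k _; exact: mgphi.
  - by apply: emeasurable_funD.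
  move=> x _; rewrite -sumgphi -EFinD -mulrDl EFinM lee_pmul ?lee_fin//.
    by apply: nneseries_ge0.
  apply: lime_le; first exact: is_cvg_nneseries.
  apply: nearW => n; rewrite sumEFin lee_fin.
  rewrite (eq_bigr (fun k => t * (k%:R * t <= f x)%R%:R)); last first.
    by move=> k _; rewrite indicE /A mem_setE.
  by apply: le_trans (sum_levels_le n t0 (f_ge0 x)) _; rewrite ge_min lexx orbT.
rewrite ge0_integralD//; last 2 first.
- by move=> x _; rewrite lee_fin mulr_ge0.
- by move=> x _; rewrite lee_fin mulr_ge0// ltW.
rewrite -addeA leeD2l//.
apply: (@le_trans _ _ (t%:E * K%:E + t%:E)%E); last first.
  by rewrite -EFinM -EFinD lee_fin -{2}(mulr1 t) -mulrDr tK.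
rewrite leeD2r//; under eq_integral do rewrite EFinM.
rewrite ge0_integralZl//; last 3 first.
- by apply/measurable_EFinP.
- by move=> x _; rewrite lee_fin.
- by rewrite lee_fin ltW.
rewrite lee_pmul2l// /K fineK ?ge0_fin_numE//.
rewrite -[B in (_ <= mu B)%E]setIT -integral_indic//; apply: ge0_le_integral => //.
- by move=> x _; rewrite lee_fin.
- by apply/measurable_EFinP.
- by apply/measurable_EFinP.
move=> x _; rewrite lee_fin indicE; have [Bx|nBx] := pselect (B x).
  by rewrite mem_set.
by rewrite phi_supp.
Qed.

End majorant.

(** * The local estimate and the descent *)

Section calculus.
Context {R : realType} {d : nat}.
Local Notation T := ('rV[R]_d * 'rV[R]_d)%type.
Local Notation I := ('I_d + 'I_d)%type.
Local Notation mu := (@lebesgue_T R d).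

Lemma integrable_Rsum (J : finType) (h : J -> T -> R) :
  (forall j, mu.-integrable setT (EFin \o h j)) ->
  mu.-integrable setT (EFin \o (fun x => \sum_j h j x)).
Proof.
move=> ih.
have := integrable_sum measurableT (index_enum J) (P := xpredT) (fun j _ => ih j).
by apply: eq_integrable => // x _; rewrite /= sumEFin.
Qed.

Lemma Rintegral_sum (J : finType) (h : J -> T -> R) :
  (forall j, mu.-integrable setT (EFin \o h j)) ->
  \int[mu]_x (\sum_j h j x) = \sum_j \int[mu]_x h j x.
Proof.
move=> ih; rewrite /Rintegral.
rewrite (eq_integral (fun x => \sum_j (EFin \o h j) x)%E); last first.
  by move=> x _; rewrite sumEFin.
rewrite (integral_sum measurableT)//.
rewrite (eq_bigr (fun j => (\int[mu]_x h j x)%:E)); first by rewrite sumEFin.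
by move=> j _; rewrite /Rintegral fineK//; exact: (integrable_fin_num measurableT (ih j)).
Qed.

Lemma vec_decomp (x : T) : x = \sum_i coord i x *: coord_vec i.
Proof.
rewrite big_sumType /=; case: x => a b.
have fstD : {morph (fun x : T => x.1) : x y / x + y} by [].
have sndD : {morph (fun x : T => x.2) : x y / x + y} by [].
apply: injective_projections.
  rewrite /= (big_morph _ fstD erefl) (big_morph _ fstD erefl) /=.
  rewrite [X in _ = _ + X]big1 ?addr0; last by move=> i _; exact: scaler0.
  exact: row_sum_delta.
rewrite /= (big_morph _ sndD erefl) (big_morph _ sndD erefl) /=.
rewrite [X in _ = X + _]big1 ?add0r; last by move=> i _; exact: scaler0.
exact: row_sum_delta.
Qed.

Lemma norm_coord_le (x : T) i : `|coord i x| <= `|x|.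
Proof.
rewrite prod_normE; case: i => k /=; rewrite le_max; apply/orP.
  left; rewrite {2}/Num.norm/= mx_normrE.
  by rewrite (le_bigmax _ (fun ij => `|x.1 ij.1 ij.2|) (ord0, k)).
right; rewrite {2}/Num.norm/= mx_normrE.
by rewrite (le_bigmax _ (fun ij => `|x.2 ij.1 ij.2|) (ord0, k)).
Qed.

Lemma norm_le_coord (x : T) (r : R) : 0 <= r ->
  (forall i, `|coord i x| <= r) -> `|x| <= r.
Proof.
move=> r0 xr; rewrite prod_normE ge_max; apply/andP; split.
  rewrite /Num.norm/= mx_normrE; apply: bigmax_le => // -[i j] _ /=.
  by rewrite ord1; exact: (xr (inl j)).
rewrite /Num.norm/= mx_normrE; apply: bigmax_le => // -[i j] _ /=.
by rewrite ord1; exact: (xr (inr j)).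
Qed.

Lemma coordB i (x y : T) : coord i (x - y) = coord i x - coord i y.
Proof. by case: i => k /=; rewrite !mxE. Qed.

(** The norm of [T] is the largest absolute coordinate, so the first-order remainder is controlled
    on cubes around [x]; the differential is expanded in the basis [coord_vec]. *)
Lemma differentiable_coord_approx (f : T -> R) (x : T) (e : R) :
  differentiable f x -> 0 < e ->
  exists2 r0 : R, 0 < r0 & forall y r, 0 <= r < r0 ->
    (forall i, `|coord i y - coord i x| <= r) ->
    `|f y - (f x + \sum_i (coord i y - coord i x) * 'D_(coord_vec i) f x)| <= e * r.
Proof.
move=> df e0; have /eqaddoP/(_ e e0) := diff_locally df.
move=> /nbhs_ballP[r0 /= r00 H]; exists r0 => // y r /andP[r_ge0 rr0] yx.
have nyx : `|y - x| <= r.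
  by apply: norm_le_coord => // i; rewrite coordB.
have := H (y - x).
rewrite -ball_normE /= sub0r normrN => /(_ (le_lt_trans nyx rr0)) => {}H.
have {H} : `|f (y - x + x) - (f x + 'd f x (y - x))| <= e * `|y - x| by [].
rewrite subrK => H.
have -> : \sum_i (coord i y - coord i x) * 'D_(coord_vec i) f x = 'd f x (y - x).
  rewrite [in RHS](vec_decomp (y - x)) linear_sum; apply: eq_bigr => i _.
  by rewrite linearZ coordB deriveE.
by apply: le_trans H _; rewrite ler_pM2l.
Qed.

End calculus.

(** * Descent from a cube to a point *)

Section descent.
Context {R : realType} {d : nat}.
Local Notation T := ('rV[R]_d * 'rV[R]_d)%type.
Local Notation I := ('I_d + 'I_d)%type.
Local Notation mu := (@lebesgue_T R d).
Implicit Types (c : T) (s : R).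
Variables (u : I -> T -> R) (w : T -> \bar R) (M : R).
Let div x := \sum_i 'D_(coord_vec i) (u i) x.
Hypotheses (int_u : forall i, mu.-integrable setT (EFin \o u i))
  (du : forall i x, differentiable (u i) x)
  (mw : measurable_fun setT w) (w_ge0 : forall x, (0 <= w x)%E)
  (w_near : forall x, \forall y \near x, ((div x + M)%:E <= w y)%E).

Lemma integrable_mul_dbump i c s : 0 < s ->
  mu.-integrable setT (EFin \o (fun x => u i x * dbump i c s x)).
Proof.
move=> s0.
have := integrableMl measurableT (int_u i) (measurable_dbump i c s).
have bd : [bounded dbump i c s x | x in [set: T]].
  exists s^-1; split; first exact: num_real.
  by move=> y sy x _ /=; rewrite (le_trans (norm_dbump_le _ _ _ s0))// ltW.
by move=> /(_ bd); apply: eq_integrable => // x _ /=; rewrite EFinM.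
Qed.

(** The weak form of the divergence: for smooth [u] it would be minus the integral of [div] against
    [bump c s]. *)
Definition bump_flux c s := \int[mu]_x \sum_i u i x * dbump i c s x.

Let W c (s : R) := (\int[mu]_x (w x * (bump c s x)%:E))%E.
(** As [s ^+ #|{: I}|] is the mass of the bump, [G m] stands for the integral of [div + m] against
    it, without [div] having to be integrated. The aim is that [W] dominates [G M]. *)
Let G m c s : R := m * s ^+ #|{: I}| - bump_flux c s.

Let integrable_flux c s : 0 < s ->
  mu.-integrable setT (EFin \o (fun x => \sum_i u i x * dbump i c s x)).
Proof. by move=> s0; apply: integrable_Rsum => i; exact: integrable_mul_dbump. Qed.

Let sum_refine_coef c (s : R) : 0 < s ->
  s ^+ #|{: I}| = \sum_(k : {ffun I -> 'I_3}) refine_coef k * (s / 2) ^+ #|{: I}|.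
Proof.
move=> s0; have s20 : 0 < s / 2 by rewrite divr_gt0.
rewrite -{1}(Rintegral_bump c s0).
rewrite (eq_Rintegral _ (g := fun x =>
  \sum_k refine_coef k * bump (refine_vec c s k) (s / 2) x)).
  rewrite Rintegral_sum.
    apply: eq_bigr => k _; rewrite RintegralZl//; first by rewrite Rintegral_bump.
    exact: integrable_bump.
  move=> k; have := integrableZl measurableT (refine_coef k)
     (integrable_bump (refine_vec c s k) s20).
  by apply: eq_integrable.
by move=> x _; rewrite bump_refine.
Qed.

Let G_refine m c s : 0 < s -> G m c s =
  \sum_k refine_coef k * G m (refine_vec c s k) (s / 2).
Proof.
move=> s0; have s20 : 0 < s / 2 by rewrite divr_gt0.
rewrite /G (sum_refine_coef c s0) mulr_sumr.
under [RHS]eq_bigr do rewrite mulrBr mulrCA.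
rewrite [RHS]sumrB; congr (_ - _).
rewrite /bump_flux.
have ik k : mu.-integrable setT (EFin \o (fun x => refine_coef k *
    \sum_i u i x * dbump i (refine_vec c s k) (s / 2) x)).
  have := integrableZl measurableT (refine_coef k)
     (integrable_flux (refine_vec c s k) s20).
  by apply: eq_integrable.
transitivity (\int[mu]_x \sum_k refine_coef k *
    \sum_i u i x * dbump i (refine_vec c s k) (s / 2) x).
  apply: eq_Rintegral => x _; under [RHS]eq_bigr do rewrite mulr_sumr.
  rewrite exchange_big; apply: eq_bigr => i _.
  by rewrite dbump_refine// mulr_sumr; apply: eq_bigr => k _; rewrite mulrCA.
rewrite Rintegral_sum//; apply: eq_bigr => k _.
by rewrite RintegralZl//; exact: integrable_flux.
Qed.

Let W_refine c s : 0 < s -> (W c s =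
  \sum_k (refine_coef k)%:E * W (refine_vec c s k) (s / 2))%E.
Proof.
move=> s0; have s20 : 0 < s / 2 by rewrite divr_gt0.
have mwb c' s' : measurable_fun setT (fun x => w x * (bump c' s' x)%:E)%E.
  by apply: emeasurable_funM => //; apply/measurable_EFinP; exact: measurable_bump.
have wb0 c' s' x : 0 < s' -> (0 <= w x * (bump c' s' x)%:E)%E.
  by move=> ?; rewrite mule_ge0// lee_fin bump_ge0.
transitivity (\int[mu]_x \sum_k ((refine_coef k)%:E *
    (w x * (bump (refine_vec c s k) (s / 2) x)%:E)))%E.
  apply: eq_integral => x _; rewrite bump_refine// -sumEFin ge0_sume_distrr.
    by apply: eq_bigr => k _; rewrite EFinM muleCA.
  by move=> k _; rewrite lee_fin mulr_ge0 ?bump_ge0// ltW// refine_coef_gt0.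
rewrite ge0_integral_sum//; last 2 first.
- by move=> k; apply: emeasurable_funM => //; exact: measurable_cst.
- by move=> k x _; rewrite mule_ge0 ?wb0// lee_fin ltW// refine_coef_gt0.
apply: eq_bigr => k _; rewrite ge0_integralZl// => [x _|]; first exact: wb0.
by rewrite lee_fin ltW// refine_coef_gt0.
Qed.

(** [W] and [G] refine with the same positive coefficients: the reverse inequality at every child
    would add up to the one at the parent. *)
Let bad_child m c s : 0 < s -> (W c s < (G m c s)%:E)%E ->
  exists k, (W (refine_vec c s k) (s / 2) <
             (G m (refine_vec c s k) (s / 2))%:E)%E.
Proof.
move=> s0; apply: contraPP => /forallNP H; apply/negP; rewrite -leNgt.
rewrite W_refine// G_refine// -sumEFin; apply: lee_sum => k _.
rewrite EFinM lee_pmul2l// ?lte_fin ?refine_coef_gt0//.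
by rewrite leNgt; apply/negP; exact: H.
Qed.

(** On the support, which lies within [2 * s] of [x], [u i] is replaced by its affine approximation
    at [x], whose contribution is exact. The remainder, at most [2 * e * s], meets the absolute mass
    of [dbump], which is [2 / s] times the mass of the bump; hence the factor 4. *)
Let flux_lower (i : I) (x : T) (e s r0 : R) (c : T) :
  0 < e -> 0 < s -> 2 * s < r0 ->
  (forall j, `|coord j x - coord j c| <= s) ->
  (forall y r, 0 <= r < r0 -> (forall j, `|coord j y - coord j x| <= r) ->
    `|u i y - (u i x + \sum_j (coord j y - coord j x) * 'D_(coord_vec j) (u i) x)|
      <= e * r) ->
  - ('D_(coord_vec i) (u i) x + 4 * e) * s ^+ #|{: I}| <=
    \int[mu]_y (u i y * dbump i c s y).
Proof.
move=> e0 s0 sr0 xc H.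
pose D j := 'D_(coord_vec j) (u i) x.
(* The affine approximation at [x] evaluated at [c], since the moments of [dbump] are centred at
   [c]. *)
pose a := u i x + \sum_j (coord j c - coord j x) * D j.
have ia : mu.-integrable setT (EFin \o (fun y => a * dbump i c s y)).
  by have := integrableZl measurableT a (integrable_dbump c s0 i); exact: eq_integrable.
have iD j : mu.-integrable setT
    (EFin \o (fun y => D j * ((coord j y - coord j c) * dbump i c s y))).
  by have := integrableZl measurableT (D j) (integrable_xdbump c s0 i j); exact: eq_integrable.
have iS := integrable_Rsum iD.
have inm : mu.-integrable setT (EFin \o (fun y => `|dbump i c s y|)).
  exact: integrable_norm (integrable_dbump c s0 i).
have ie : mu.-integrable setT (EFin \o (fun y => (2 * e * s) * `|dbump i c s y|)).
  by have := integrableZl measurableT (2 * e * s) inm; exact: eq_integrable.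
have iaS : mu.-integrable setT (EFin \o (fun y => a * dbump i c s y +
    \sum_j D j * ((coord j y - coord j c) * dbump i c s y))).
  by have := integrableD measurableT ia iS; exact: eq_integrable.
have iL : mu.-integrable setT (EFin \o (fun y => a * dbump i c s y +
    \sum_j D j * ((coord j y - coord j c) * dbump i c s y) -
    (2 * e * s) * `|dbump i c s y|)).
  by have := integrableB measurableT iaS ie; exact: eq_integrable.
apply: (le_trans _ (le_Rintegral measurableT iL (integrable_mul_dbump i c s0) _)).
  rewrite RintegralB// RintegralD// Rintegral_sum//.
  rewrite RintegralZl//; last exact: integrable_dbump.
  rewrite Rintegral_dbump// mulr0 add0r RintegralZl// -mulrA Rintegral_norm_dbump//.
  rewrite (eq_bigr (fun j => - (D j * (j == i)%:R * s ^+ #|{: I}|))); last first.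
    move=> j _; rewrite RintegralZl//; last exact: integrable_xdbump.
    by rewrite Rintegral_xdbump// !mulNr mulrN mulrA.
  rewrite (bigD1 i)//= eqxx mulr1 big1 ?addr0 /D; last first.
    by move=> j /negbTE ->; rewrite mulr0 mul0r oppr0.
  by rewrite le_eqVlt; apply/orP; left; apply/eqP; ring.
move=> y _; have [yc|] := pselect (forall j, `|coord j y - coord j c| <= s); last first.
  move=> /existsNP[j /negP]; rewrite -ltNge => yj.
  rewrite (dbump_supp _ yj) normr0 !mulr0 subr0 add0r big1// => k _.
  by rewrite !mulr0.
have := H y (2 * s) _ _; rewrite sr0 mulr_ge0 ?(ltW s0)// => /(_ isT) /=.
have yx j : `|coord j y - coord j x| <= 2 * s.
  have := yc j; have := xc j; rewrite !ler_norml => /andP[? ?] /andP[? ?].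
  by apply/andP; split; lra.
move=> /(_ yx); set A := (X in u i y - X) => HA.
have -> : a * dbump i c s y + \sum_j D j * ((coord j y - coord j c) * dbump i c s y) =
    A * dbump i c s y.
  have -> : \sum_j D j * ((coord j y - coord j c) * dbump i c s y) =
      (\sum_j D j * (coord j y - coord j c)) * dbump i c s y.
    by rewrite mulr_suml; apply: eq_bigr => j _; rewrite mulrA.
  rewrite /A /a -mulrDl -addrA -big_split /=; congr ((_ + _) * _).
  by apply: eq_bigr => j _; rewrite /D; ring.
rewrite lerBlDr -lerBlDl -mulrBl; apply: le_trans (ler_norm _) _.
by rewrite normrM ler_wpM2r// distrC (le_trans HA)// mulrCA mulrA.
Qed.

Let cube_near (x c : T) (s r : R) : 0 < s -> 2 * s < r ->
  (forall j, `|coord j x - coord j c| <= s) ->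
  forall y, bump c s y != 0 -> forall j, `|coord j y - coord j x| < r.
Proof.
move=> s0 sr xc y by0 j; have yc : `|coord j y - coord j c| <= s.
  by rewrite leNgt; apply: contra by0 => yc; rewrite (bump_supp yc).
have := xc j; move: yc; rewrite !ler_norml ltr_norml => /andP[? ?] /andP[? ?].
by apply/andP; split; lra.
Qed.

(** On small cubes containing [x], [w] is at least [div x + M] and [flux_lower] bounds the flux; the
    loss [e] pays for the linearization. *)
Let local_estimate (x : T) (e : R) : 0 < e ->
  exists2 r0 : R, 0 < r0 & forall c s, 0 < s -> 2 * s < r0 ->
    (forall j, `|coord j x - coord j c| <= s) -> ((G (M - e) c s)%:E <= W c s)%E.
Proof.
move=> e0; pose N : R := #|{: I}|%:R.
have N0 : 0 <= N by rewrite ler0n.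
(* Each of the [N] components loses [4 * t]. The denominator [4 * N + 1] stays positive when
   [d = 0]. *)
have [t t0 tN] : exists2 t : R, 0 < t & 4 * t * N <= e.
  have N1 : 0 < 4 * N + 1 by lra.
  exists (e / (4 * N + 1)); first by rewrite divr_gt0.
  rewrite -[leRHS](divfK (lt0r_neq0 N1)) mulrAC [leRHS]mulrC ler_pM2r ?divr_gt0//.
  by lra.
have /choice[r Hr] : forall i, exists r0 : R, 0 < r0 /\
    forall y r, 0 <= r < r0 -> (forall j, `|coord j y - coord j x| <= r) ->
    `|u i y - (u i x + \sum_j (coord j y - coord j x) * 'D_(coord_vec j) (u i) x)|
      <= t * r.
  by move=> i; have [r0 ? ?] := differentiable_coord_approx (du i x) t0; exists r0.
have /nbhs_coordP[rw rw0 Hw] := w_near x.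
exists (\big[Num.min/rw]_i r i).
  by apply: lt_bigmin => // i _; have [] := Hr i.
move=> c s s0 sr xc.
have srw : 2 * s < rw by apply: lt_le_trans sr (bigmin_le_id _ _ _ _).
have sri i : 2 * s < r i by apply: lt_le_trans sr (bigmin_le _ _ _).
pose b := s ^+ #|{: I}|.
have b0 : 0 <= b by rewrite exprn_ge0// ltW.
have Wge0 : (0 <= W c s)%E.
  by apply: integral_ge0 => y _; rewrite mule_ge0// lee_fin bump_ge0.
have : (((div x + M) * b)%:E <= W c s)%E.
  (* Where [div x + M] is negative, nonnegativity of [w] is enough. *)
  have [dM|dM] := leP 0 (div x + M); last first.
    by apply: le_trans Wge0; rewrite lee_fin nmulr_rle0.
  rewrite EFinM /b -(Rintegral_bump c s0) /Rintegral fineK; last first.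
    exact: integrable_fin_num (integrable_bump c s0).
  rewrite -ge0_integralZl//; last 2 first.
  - by apply/measurable_EFinP; exact: measurable_bump.
  - by move=> y _; rewrite lee_fin bump_ge0.
  apply: ge0_le_integral => //.
  - by move=> y _; rewrite -EFinM lee_fin mulr_ge0// bump_ge0.
  - by apply: emeasurable_funM => //; apply/measurable_EFinP; exact: measurable_bump.
  - by apply: emeasurable_funM => //; apply/measurable_EFinP; exact: measurable_bump.
  move=> y _; have [->|by0] := eqVneq (bump c s y) 0; first by rewrite !mule0.
  apply: lee_wpmul2r; first by rewrite lee_fin bump_ge0.
  by apply: Hw; exact: cube_near xc _ by0.
apply: le_trans; rewrite lee_fin /G -/b.
have flux : - (div x + 4 * t * N) * b <= bump_flux c s.
  rewrite /bump_flux Rintegral_sum; last by move=> i; exact: integrable_mul_dbump.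
  have -> : - (div x + 4 * t * N) * b =
      \sum_i - ('D_(coord_vec i) (u i) x + 4 * t) * b.
    by rewrite -mulr_suml sumrN big_split /= sumr_const -[_ *+ #|_|]mulr_natr.
  by apply: ler_sum => i _; apply: (flux_lower t0 s0 (sri i) xc); have [] := Hr i.
rewrite lerBlDr -lerBlDl; apply: le_trans flux.
by rewrite -mulrBl ler_wpM2r//; lra.
Qed.

(** The centre moves by at most [s n / 2], which is [s n - s n.+1], so the cubes are nested along
    every axis; the suprema of the lower ends give a common point. *)
Let nested_cubes (c : nat -> T) (s : nat -> R) :
  (forall n, 0 <= s n) ->
  (forall n, s n.+1 = s n / 2) ->
  (forall n i, `|coord i (c n.+1) - coord i (c n)| <= s n / 2) ->
  exists x, forall n i, `|coord i x - coord i (c n)| <= s n.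
Proof.
move=> s0 sS cS.
pose lo i n := coord i (c n) - s n; pose hi i n := coord i (c n) + s n.
have step n i : lo i n <= lo i n.+1 /\ hi i n.+1 <= hi i n.
  have := cS n i; rewrite /lo /hi sS ler_norml => /andP[? ?]; split; lra.
have lo_nd i : {homo lo i : n m / (n <= m)%N >-> n <= m}.
  by apply: homo_leq => // [? ? ?|n]; [exact: le_trans|have [] := step n i].
have hi_ni i : {homo hi i : n m / (n <= m)%N >-> m <= n}.
  apply: (homo_leq (r := fun a b => b <= a)) => // [a b c'|n].
    by move=> ba cb; exact: le_trans cb ba.
  by have [] := step n i.
have lo_hi i n m : lo i n <= hi i m.
  apply: le_trans (lo_nd i _ _ (leq_maxl n m)) _.
  apply: le_trans (hi_ni i _ _ (leq_maxr n m)).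
  by rewrite /lo /hi; have := s0 (maxn n m); lra.
exists (of_coord (fun i => sup (range (lo i)))) => n i; rewrite of_coordK.
have ub m : ubound (range (lo i)) (hi i m) by move=> _ [k _ <-].
have lo_le : lo i n <= sup (range (lo i)).
  by apply: ub_le_sup; [exists (hi i 0%N)|exists n].
have le_hi : sup (range (lo i)) <= hi i n.
  by apply: ge_sup; [exists (lo i 0%N), 0%N|].
by rewrite ler_norml; move: lo_le le_hi; rewrite /lo /hi => ? ?; apply/andP; split; lra.
Qed.

Lemma bump_flux_le c s : 0 < s ->
  ((M * s ^+ #|{: I}| - bump_flux c s)%:E <= \int[mu]_x (w x * (bump c s x)%:E))%E.
Proof.
move=> s0; rewrite -/(G M c s) -/(W c s).
(* The slack [e], a fraction of the volume, is inherited unchanged by the subcubes and matches the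
   loss in [local_estimate]. *)
suff H e : 0 < e -> ((G (M - e) c s)%:E <= W c s)%E.
  apply/lee_addgt0Pr => e e0.
  have sn0 : 0 < s ^+ #|{: I}| by rewrite exprn_gt0.
  have := H (e / s ^+ #|{: I}|) (divr_gt0 e0 sn0).
  rewrite /G mulrBl divfK ?gt_eqF// addrAC EFinB.
  by rewrite leeBlDr.
move=> e0; rewrite leNgt; apply/negP => bad.
pose Bad (p : T * R) := (W p.1 p.2 < (G (M - e) p.1 p.2)%:E)%E.
(* The choice is made total by keeping the same centre when the pair is not a bad cube. *)
have /choice[h hP] : forall p : T * R, exists c', 0 < p.2 -> Bad p ->
    Bad (c', p.2 / 2) /\ forall i, `|coord i c' - coord i p.1| <= p.2 / 2.
  move=> p; have [[p0 bp]|np] := pselect (0 < p.2 /\ Bad p); last first.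
    by exists p.1 => p0 bp; exfalso; apply: np.
  have [k bk] := bad_child p0 bp.
  by exists (refine_vec p.1 p.2 k) => _ _; split => // i; exact: refine_vec_dist.
pose p n := iter n (fun q => (h q, q.2 / 2)) (c, s).
have pP n : 0 < (p n).2 /\ Bad (p n).
  elim: n => [//|n [p0 bp]]; split; first by rewrite /= divr_gt0.
  by have [] := hP _ p0 bp.
have [x xp] : exists x, forall n i, `|coord i x - coord i (p n).1| <= (p n).2.
  apply: nested_cubes => // n; first by have [/ltW] := pP n.
  by move=> i; have [p0 bp] := pP n; have [_] := hP _ p0 bp; exact.
have [r0 r00 local] := local_estimate x e0.
have p2E n : (p n).2 = s / 2 ^+ n.
  by elim: n => [|n IHn]; rewrite ?expr0 ?divr1//= IHn exprSr invfM mulrA.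
have [n nr0] : exists n, 2 * (p n).2 < r0.
  exists (Num.bound (2 * s / r0)); rewrite p2E mulrA ltr_pdivrMr ?exprn_gt0//.
  rewrite [ltRHS]mulrC -ltr_pdivrMr//; apply: upper_nthrootP; exact: leqnn.
have [p0] := pP n; rewrite /Bad ltNge => /negP; apply.
exact: local.
Qed.

End descent.

(** * The divergence theorem *)

Section divergence_theorem.
Context {R : realType} {d : nat}.
Local Notation T := ('rV[R]_d * 'rV[R]_d)%type.
Local Notation I := ('I_d + 'I_d)%type.
Local Notation mu := (@lebesgue_T R d).
Implicit Types (c : T) (s : R).

Let cube c s : set T := [set x | forall i, `|coord i x - coord i c| <= s].

(** As a level set of a product of indicators, the cube gets its measurability and its finite
    measure from the product integral. *)
Let cubeE c s : cube c s =
  (fun x => \prod_i \1_`[coord i c - s, coord i c + s]%classic (coord i x) : R)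
    @^-1` [set 1].
Proof.
have inE_itv i x : (`|coord i x - coord i c| <= s) =
    (coord i x \in `[coord i c - s, coord i c + s]).
  rewrite in_itv /= ler_norml; lra.
apply/seteqP; split=> [x xc /=|x /= x1 i].
  rewrite big1// => i _; rewrite indicE mem_setE -inE_itv.
  by have := xc i => ->.
rewrite inE_itv; move: x1; rewrite (bigD1 i)//= indicE mem_setE.
case: (_ \in _) => //; rewrite mul0r => /esym/eqP; rewrite oner_eq0.
by [].
Qed.

Let integrable_cube c s : mu.-integrable setT (EFin \o (fun x =>
  \prod_i \1_`[coord i c - s, coord i c + s]%classic (coord i x) : R)).
Proof.
apply: (integrable_Rintegral_prod_coord
  (F := fun i => \1_`[coord i c - s, coord i c + s]%classic) _).1 => i.
exact: integrable_indic_itv.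
Qed.

Let measurable_cube c s : measurable (cube c s).
Proof.
rewrite cubeE -[X in measurable X]setTI.
have /measurable_EFinP mP := measurable_int _ (integrable_cube c s).
exact: (mP measurableT _ (measurable_set1 1)).
Qed.

Let cube_finite c s : (mu (cube c s) < +oo)%E.
Proof.
have /integrableP[mP] := integrable_cube c s; apply: le_lt_trans.
rewrite -[cube c s in leLHS]setIT -integral_indic//; apply: ge0_le_integral => //.
- by apply/measurable_EFinP; exact: measurable_indic.
- exact: measurableT_comp.
move=> x _ /=; rewrite lee_fin indicE.
have [Cx|nCx] := pselect (cube c s x); last by rewrite memNset//= normr_ge0.
by rewrite mem_set//; move: Cx; rewrite cubeE /= => ->; rewrite normr1.
Qed.

Section field.
Variables (u : I -> T -> R).
Let div x := \sum_i 'D_(coord_vec i) (u i) x.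
Hypotheses (int_u : forall i, mu.-integrable setT (EFin \o u i))
  (du : forall i x, differentiable (u i) x)
  (int_div : mu.-integrable setT (EFin \o div)).

Let mdiv : measurable_fun setT div.
Proof. by apply/measurable_EFinP; exact: measurable_int int_div. Qed.

(** Truncation from below makes [trunc_div M x + M] nonnegative, as [locally_majorizing] requires,
    and for [0 <= M] stays dominated by the absolute value of [div]. *)
Let trunc_div M x := Num.max (div x) (- M).

Let norm_trunc_div_le M x : 0 <= M -> `|trunc_div M x| <= `|div x|.
Proof.
move=> M0; rewrite /trunc_div; have [dM|//] := leP (div x) (- M).
by rewrite normrN ger0_norm// ler0_norm; lra.
Qed.

Let mtrunc_div M : measurable_fun setT (trunc_div M).
Proof. by apply: measurable_maxr => //; exact: measurable_cst. Qed.

Let integrable_trunc_bump M c s : 0 <= M -> 0 < s ->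
  mu.-integrable setT (EFin \o (fun x => trunc_div M x * bump c s x)).
Proof.
move=> M0 s0; apply: (le_integrable measurableT _ _ int_div).
  apply/measurable_EFinP; apply: measurable_funM => //; exact: measurable_bump.
move=> x _; rewrite lee_fin normrM -[leRHS]mulr1 ler_pM ?norm_trunc_div_le//.
by rewrite ger0_norm ?bump_le1 ?bump_ge0.
Qed.

(** [bump_flux_le] is applied to majorants of [trunc_div M + M] whose weighted integrals exceed that
    of the function by at most [e]; the contribution of [M] then cancels on both sides. *)
Let flux_le_trunc M c s : 0 <= M -> 0 < s ->
  - bump_flux u c s <= \int[mu]_x (trunc_div M x * bump c s x).
Proof.
move=> M0 s0.
pose f x := trunc_div M x + M.
have f0 x : 0 <= f x by rewrite /f /trunc_div -lerBlDr sub0r le_max lexx orbT.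
have mf : measurable_fun setT f by apply: measurable_funD => //; exact: measurable_cst.
have bump_supp_cube x : ~ cube c s x -> bump c s x = 0.
  by move=> /existsNP[i /negP]; rewrite -ltNge; exact: bump_supp.
have ifb : mu.-integrable setT (EFin \o (fun x => f x * bump c s x)).
  have iM : mu.-integrable setT (EFin \o (fun x => M * bump c s x)).
    by have := integrableZl measurableT M (integrable_bump c s0); exact: eq_integrable.
  have := integrableD measurableT (integrable_trunc_bump c M0 s0) iM.
  by apply: eq_integrable => // x _; rewrite /= -EFinD /f mulrDl.
have le_e e : 0 < e ->
    M * s ^+ #|{: I}| - bump_flux u c s <= \int[mu]_x (f x * bump c s x) + e.
  move=> e0; have [w [mw w0 wf wint]] := locally_majorizing (measurable_cube c s)
    (cube_finite c s) (measurable_bump c s) (fun x => bump_ge0 c x s0)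
    (fun x => bump_le1 c x s0) bump_supp_cube mf f0 e0.
  have w_near x : \forall y \near x, ((div x + M)%:E <= w y)%E.
    apply: filterS (wf x) => y; apply: le_trans.
    by rewrite lee_fin lerD2r /trunc_div le_max lexx.
  have := le_trans (bump_flux_le int_u du mw w0 w_near c s0) wint.
  move=> H; rewrite -lee_fin [leRHS]EFinD /Rintegral fineK//.
  exact: integrable_fin_num ifb.
have : M * s ^+ #|{: I}| - bump_flux u c s <= \int[mu]_x (f x * bump c s x).
  by apply/ler_addgt0Pr.
have -> : \int[mu]_x (f x * bump c s x) =
    \int[mu]_x (trunc_div M x * bump c s x) + M * s ^+ #|{: I}|.
  under eq_Rintegral do rewrite /f mulrDl.
  have iM : mu.-integrable setT (EFin \o (fun x => M * bump c s x)).
    by have := integrableZl measurableT M (integrable_bump c s0); exact: eq_integrable.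
  rewrite RintegralD//; last exact: integrable_trunc_bump.
  by rewrite RintegralZl ?Rintegral_bump//; exact: integrable_bump.
by rewrite addrC lerD2r.
Qed.

Let bump_near1 s (x : T) : 0 < s -> 1 - (\sum_i `|coord i x|) / s <= bump 0 s x.
Proof.
move=> s0; have c0 i : coord i (0 : T) = 0 by case: i => k; rewrite /= mxE.
have -> : bump 0 s x = \prod_i hat 0 s (coord i x).
  by apply: eq_bigr => i _; rewrite c0.
rewrite mulr_suml.
(* For factors between 0 and 1, the product is at least 1 minus the sum of their defects. *)
apply: (@le_trans _ _ (1 - \sum_i (1 - hat 0 s (coord i x)))).
  rewrite lerD2l lerN2; apply: ler_sum => i _.
  by rewrite lerBlDr addrC -lerBlDr hat_near1.
elim: (index_enum _) => [|i r IHr]; first by rewrite !big_nil subr0.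
rewrite !big_cons; have h0 := hat_ge0 0 (coord i x) s0.
have h1 := hat_le1 0 (coord i x) s0.
have p1 : \prod_(j <- r) hat 0 s (coord j x) <= 1.
  by apply: prodr_ile1 => j _; rewrite hat_ge0//= hat_le1.
by nra.
Qed.

Let cvg_bump (x : T) : bump 0 n.+1%:R x @[n --> \oo] --> (1 : R).
Proof.
apply: (@squeeze_cvgr _ _ _ _ (fun n => 1 - (\sum_i `|coord i x|) * n.+1%:R^-1)
  (cst 1)).
- by apply: nearW => n; rewrite bump_near1 ?bump_le1.
- rewrite -[X in _ --> X]subr0 -[X in _ --> _ - X](mulr0 (\sum_i `|coord i x|)).
  by apply: cvgB; [exact: cvg_cst|apply: cvgM; [exact: cvg_cst|exact: cvg_harmonic]].
- exact: cvg_cst.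
Qed.

Let cvg_trunc_bump x :
  trunc_div n.+1%:R x * bump 0 n.+1%:R x @[n --> \oo] --> div x.
Proof.
rewrite -[X in _ --> X]mulr1; apply: cvgM; last exact: cvg_bump.
(* Once [n] exceeds the absolute value of [div x], the truncation is inactive. *)
apply: cvg_near_cst; exists (Num.bound `|div x|) => // n /= dn.
rewrite /trunc_div; apply/max_idPl; rewrite lerNl (le_trans (ler_norm _))// normrN.
rewrite (le_trans (ltW (archi_boundP (normr_ge0 _))))// ler_nat.
exact: leqW.
Qed.

(** [dbump] is at most [s^-1] in absolute value and [u] is integrable, so the flux out of large
    cubes is negligible. *)
Let flux_bound : exists K, forall s, 0 < s -> bump_flux u 0 s <= K * s^-1.
Proof.
exists (\sum_i \int[mu]_x `|u i x|) => s s0; rewrite /bump_flux.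
rewrite Rintegral_sum; last by move=> i; exact: integrable_mul_dbump.
rewrite mulr_suml; apply: ler_sum => i _; rewrite -RintegralZr//; last first.
  exact: integrable_norm (int_u i).
apply: le_Rintegral => //.
- exact: integrable_mul_dbump.
- have := integrableZr measurableT s^-1 (integrable_norm (int_u i)).
  exact: eq_integrable.
move=> x _; apply: le_trans (ler_norm _) _.
by rewrite normrM ler_wpM2l// norm_dbump_le.
Qed.

(** In [flux_le_trunc] both [M] and [s] are set to [n.+1]: the flux tends to 0, and the right side
    converges by domination by the absolute value of [div]. *)
Lemma Rintegral_divergence_ge0 : 0 <= \int[mu]_x div x.
Proof.
have [K HK] := flux_bound.
have [|||||_ _ cvg_int] := @dominated_convergence _ T R mu setT measurableT
  (fun n x => (trunc_div n.+1%:R x * bump 0 n.+1%:R x)%:E) (EFin \o div)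
  (fun x => `|(div x)%:E|%E).
- move=> n; apply/measurable_EFinP; apply: measurable_funM => //.
  exact: measurable_bump.
- exact/measurable_EFinP.
- by apply: aeW => x _; apply/cvg_EFin; [exact: nearW|exact: cvg_trunc_bump].
- exact: integrable_abse int_div.
- apply: aeW => x n _; rewrite lee_fin normrM -[leRHS]mulr1.
  by rewrite ler_pM ?norm_trunc_div_le// ger0_norm ?bump_le1 ?bump_ge0.
have K0 : (- (K * n.+1%:R^-1))%:E @[n --> \oo] --> 0%:E.
  apply/cvg_EFin; first exact: nearW.
  rewrite -oppr0 -[X in _ --> - X](mulr0 K).
  by apply: cvgN; apply: cvgM; [exact: cvg_cst|exact: cvg_harmonic].
have : (0%:E <= \int[mu]_x (div x)%:E)%E.
  apply: (lee_cvg_to K0 cvg_int); apply: nearW => n.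
  have n0 : 0 < n.+1%:R :> R by [].
  have := flux_le_trunc 0 (ler0n R n.+1) n0.
  rewrite -lee_fin {1}/Rintegral fineK; last first.
    by apply: integrable_fin_num => //; exact: integrable_trunc_bump.
  by apply: le_trans; rewrite lee_fin lerN2 HK.
by rewrite -{1}(fineK (integrable_fin_num measurableT int_div)) lee_fin.
Qed.

End field.

(** The one-sided bound holds for every such field, hence for [u] and for [- u]. *)
Lemma Rintegral_divergence (u : I -> T -> R) :
  (forall i, mu.-integrable setT (EFin \o u i)) ->
  (forall i x, differentiable (u i) x) ->
  mu.-integrable setT
    (EFin \o (fun x => \sum_i 'D_(coord_vec i) (u i) x)) ->
  \int[mu]_x (\sum_i 'D_(coord_vec i) (u i) x) = 0.
Proof.
move=> iu du idiv; apply/eqP; rewrite eq_le; apply/andP; split; last first.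
  exact: Rintegral_divergence_ge0.
pose v i : T -> R := - u i.
have dvE x : \sum_i 'D_(coord_vec i) (v i) x = -1 * \sum_i 'D_(coord_vec i) (u i) x.
  rewrite mulN1r -sumrN; apply: eq_bigr => i _; rewrite /v deriveN//.
  exact: diff_derivable.
have iv i : mu.-integrable setT (EFin \o v i).
  by have := integrableN (iu i); exact: eq_integrable.
have dv i x : differentiable (v i) x by exact: differentiableN.
have idv : mu.-integrable setT
    (EFin \o (fun x => -1 * \sum_i 'D_(coord_vec i) (u i) x)).
  by have := integrableZl measurableT (-1) idiv; exact: eq_integrable.
have := @Rintegral_divergence_ge0 v iv dv.
rewrite (funext dvE).
by move=> /(_ idv); rewrite RintegralZl// mulN1r oppr_ge0.
Qed.

End divergence_theorem.

(** * The time derivative *)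

Section pairing_divergence.
Context {R : realType} {d : nat}.
Local Notation T := ('rV[R]_d * 'rV[R]_d)%type.
Local Notation I := ('I_d + 'I_d)%type.
Local Notation mu := (@lebesgue_T R d).

Let coord_is_linear i : linear (coord i : T -> R).
Proof. by move=> a x y; case: i => k /=; rewrite !mxE. Qed.

HB.instance Definition _ i :=
  GRing.isLinear.Build R T R *:%R (coord i) (coord_is_linear i).

Lemma differentiable_coord_comp i (F : T -> T) x :
  differentiable F x -> differentiable (fun y => coord i (F y)) x.
Proof.
move=> dF; apply: (differentiable_comp dF).
by apply: linear_differentiable; exact: continuous_coord.
Qed.

Lemma divergenceE (F : T -> T) x :
  divergence F x = \sum_i 'D_(coord_vec i) (fun y => coord i (F y)) x.
Proof. by rewrite big_sumType. Qed.

Lemma dotT_gradientE (g : T -> R) (b x : T) :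
  dotT (gradient g x) b = \sum_i 'D_(coord_vec i) g x * coord i b.
Proof.
by rewrite big_sumType; congr (_ + _); apply: eq_bigr => k _; rewrite mxE.
Qed.

(** The divergence theorem for [g F], whose divergence is the sum of the two integrands by the
    product rule. Integrability of [g] times the norm of [F] makes every component integrable. *)
Lemma pairing_gradient (g : T -> R) (F : T -> T) :
  (forall x, differentiable g x) -> (forall x, differentiable F x) ->
  mu.-integrable setT (EFin \o (fun x => g x * `|F x|)) ->
  mu.-integrable setT (EFin \o (fun x => dotT (gradient g x) (F x))) ->
  mu.-integrable setT (EFin \o (fun x => g x * divergence F x)) ->
  pairing_vf (gradient g) F = - pairing g (divergence F).
Proof.
move=> dg dF igF idot idiv.
pose u i x := g x * coord i (F x).
have dFi i x := differentiable_coord_comp i (dF x).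
have du i x : differentiable (u i) x by exact: differentiableM.
have iu i : mu.-integrable setT (EFin \o u i).
  apply: (le_integrable measurableT _ _ igF).
    apply/measurable_EFinP; apply: continuous_measurable_rV2 => x.
    exact: differentiable_continuous.
  move=> x _; rewrite lee_fin !normrM normr_id ler_wpM2l//.
  exact: norm_coord_le.
have divE x : \sum_i 'D_(coord_vec i) (u i) x =
    dotT (gradient g x) (F x) + g x * divergence F x.
  rewrite dotT_gradientE divergenceE mulr_sumr -big_split; apply: eq_bigr => i _.
  rewrite /u [LHS]deriveM; try exact: diff_derivable.
  by rewrite addrC /GRing.scale /= [X in X + _]mulrC.
have isum : mu.-integrable setT (EFin \o (fun x => \sum_i 'D_(coord_vec i) (u i) x)).
  by rewrite (funext divE); have := integrableD measurableT idot idiv; exact: eq_integrable.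
have := Rintegral_divergence iu du isum.
rewrite (funext divE) RintegralD// => /eqP; rewrite addr_eq0 => /eqP.
by [].
Qed.

End pairing_divergence.

(** * The chain rule along a curve of densities *)

Section frechet.
Context {R : realType} {d : nat}.
Local Notation T := ('rV[R]_d * 'rV[R]_d)%type.
Variable E : normed_fun_space R d.
Implicit Types f g : T -> R.

Lemma nfs_sub f g : nfs_dom E f -> nfs_dom E g -> nfs_dom E (f \- g).
Proof.
move=> Ef Eg; have := nfs_add Ef (nfs_scale (-1) Eg).
by congr nfs_dom; apply/funext => x /=; rewrite mulN1r.
Qed.

Lemma nfs_normB f g : nfs_dom E f -> nfs_dom E g ->
  nfs_norm E (f \- g) <= nfs_norm E f + nfs_norm E g.
Proof.
move=> Ef Eg.
have -> : f \- g = f \+ (-1 \*o g) by apply/funext => x /=; rewrite mulN1r.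
have := nfs_normD Ef (nfs_scale (-1) Eg).
by rewrite nfs_normZ// normrN1 mul1r.
Qed.

Lemma nfs_norm_ge0 f : nfs_dom E f -> 0 <= nfs_norm E f.
Proof.
move=> Ef; have := nfs_normB Ef Ef.
have -> : f \- f = 0 \*o f by apply/funext => x /=; rewrite subrr mul0r.
by rewrite nfs_normZ// normr0 mul0r; lra.
Qed.

(** [D] is minus the time derivative, so the increment of [rho] is [h] times [k h \- D], with [k h]
    tending to 0 in [E]. This increment is of order [h], which makes the Frechet remainder
    negligible; continuity of the pairing disposes of [k h]. *)
Lemma frechet_has_time_derivative (V : (T -> R) -> R) (g D : T -> R)
    (rho : R -> T -> R) (t : R) :
  is_frechet_differential E V (rho t) g ->
  (forall s, 0 <= s -> densities (rho s)) ->
  (forall s, 0 <= s -> nfs_dom E (rho s)) -> 0 <= t -> nfs_dom E D ->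
  nfs_norm E (fun x => h^-1 * (rho (t + h) x - rho t x) + D x)
    @[h --> time_increments t] --> 0 ->
  has_time_derivative (fun s => V (rho s)) t (- pairing g D).
Proof.
move=> [int_g [C HC] frechet] dens dom t0 ED cvg_rho.
pose k (h : R) x := h^-1 * (rho (t + h) x - rho t x) + D x.
have Erho_t := dom t t0.
have pairD (h : T -> R) : nfs_dom E h -> pairing g (h \- D) = pairing g h - pairing g D.
  move=> Eh; rewrite /pairing.
  rewrite -RintegralB//; last 2 first.
  - exact: int_g.
  - exact: int_g.
  by apply: eq_Rintegral => x _; rewrite -mulrBr.
have pairZ a (h : T -> R) : nfs_dom E h -> pairing g (a \*o h) = a * pairing g h.
  move=> Eh; rewrite /pairing -RintegralZl//; last exact: int_g.
  by apply: eq_Rintegral => x _; rewrite mulrCA.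
have ND0 := nfs_norm_ge0 ED.
have FF : Filter (time_increments t) by exact: within_filter.
apply/cvgrPdist_le => e e0.
(* The cap 1 bounds the increment of [rho] by [1 + nfs_norm E D] times the absolute value of [h];
   the other term makes the pairing with [k h] at most [e / 2]. [C] may have any sign, hence its
   absolute value plus 1. *)
pose eta := Num.min 1 (e / (2 * (`|C| + 1))).
have C1 : 0 < 2 * (`|C| + 1) by have := normr_ge0 C; lra.
have eta0 : 0 < eta by rewrite lt_min ltr01 divr_gt0.
have D1 : 0 < 2 * (1 + nfs_norm E D) by lra.
(* This precision turns the Frechet remainder, once divided by [h], into at most [e / 2]. *)
have [delta delta0 Hdelta] := frechet _ (divr_gt0 e0 D1).
have near_k : \forall h \near time_increments t, `|nfs_norm E (k h)| <= eta.
  have /cvgrPdist_le/(_ _ eta0) := cvg_rho.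
  by apply: filterS => h; rewrite sub0r normrN.
(* Only where [0 <= t + h] is [rho (t + h)] known to be a density, hence an admissible
   perturbation. *)
have near_dom : \forall h \near time_increments t, 0 <= t + h by exact: withinT.
have near_neq : \forall h \near time_increments t, h != 0.
  have h0 : \forall h \near (0 : R)^', h != 0 by exact: nbhs_dnbhs_neq.
  exact: (cvg_within _ h0).
have near_lt : \forall h \near time_increments t, `|h| < delta / (1 + nfs_norm E D).
  have r0 : 0 < delta / (1 + nfs_norm E D) by rewrite divr_gt0//; lra.
  exact: (cvg_within _ (dnbhs0_lt (V := R) r0)).
near=> h.
have h_neq0 : h != 0 by near: h.
have th0 : 0 <= t + h by near: h.
have kh : `|nfs_norm E (k h)| <= eta by near: h.
have h_lt : `|h| < delta / (1 + nfs_norm E D) by near: h.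
have Erho := dom _ th0.
have Ek : nfs_dom E (k h).
  exact: nfs_add (nfs_scale h^-1 (nfs_sub Erho Erho_t)) ED.
have rhoE : rho (t + h) \- rho t = h \*o (k h \- D).
  by apply/funext => x /=; rewrite /k addrK mulrA divff// mul1r.
have N_le : nfs_norm E (rho (t + h) \- rho t) <= `|h| * (1 + nfs_norm E D).
  rewrite rhoE nfs_normZ; last exact: nfs_sub.
  rewrite ler_wpM2l// (le_trans (nfs_normB Ek ED))// lerD2r.
  by rewrite (le_trans (ler_norm _))// (le_trans kh)// ge_min lexx.
have N_lt : nfs_norm E (rho (t + h) \- rho t) < delta.
  by apply: le_lt_trans N_le _; rewrite -ltr_pdivlMr//; lra.
have := Hdelta _ (dens _ th0) Erho N_lt.
rewrite {1}rhoE pairZ; last exact: nfs_sub.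
rewrite pairD// => HV.
set q := V (rho (t + h)) - V (rho t) in HV *.
have -> : - pairing g D - h^-1 * q =
    - (h^-1 * (q - h * (pairing g (k h) - pairing g D))) - pairing g (k h).
  by field.
apply: le_trans (ler_normB _ _) _; rewrite normrN normrM normfV.
have He : `|h|^-1 * `|q - h * (pairing g (k h) - pairing g D)| <= e / 2.
  rewrite ler_pdivrMl ?normr_gt0//; apply: le_trans HV _.
  apply: le_trans (ler_wpM2l _ N_le) _; first by rewrite divr_ge0// ltW.
  rewrite le_eqVlt; apply/orP; left; apply/eqP; field.
  by apply/lt0r_neq0; lra.
have Hk : `|pairing g (k h)| <= e / 2.
  apply: le_trans (HC _ Ek) _.
  apply: (@le_trans _ _ ((`|C| + 1) * eta)).
    apply: le_trans (ler_norm _) _; rewrite normrM ler_pM//.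
    by rewrite lerDl.
  apply: (@le_trans _ _ ((`|C| + 1) * (e / (2 * (`|C| + 1))))).
    by rewrite ler_wpM2l ?addr_ge0// ge_min lexx orbT.
  rewrite le_eqVlt; apply/orP; left; apply/eqP; field.
  by apply/lt0r_neq0; have := normr_ge0 C; lra.
lra.
Unshelve. all: by end_near.
Qed.

End frechet.

Theorem lemma1 (R : realType) (d : nat) (E : normed_fun_space R d)
    (v : R -> 'rV[R]_d * 'rV[R]_d -> 'rV[R]_d * 'rV[R]_d)
    (rho : R -> 'rV[R]_d * 'rV[R]_d -> R)
    (V : ('rV[R]_d * 'rV[R]_d -> R) -> R)
    (dV : ('rV[R]_d * 'rV[R]_d -> R) -> 'rV[R]_d * 'rV[R]_d -> R)
    (rho_density : forall t, 0 <= t -> densities (rho t))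
    (rho_solution : continuity_equation E v rho)
    (V_frechet : forall t, 0 <= t ->
      is_frechet_differential E V (rho t) (dV (rho t)))
    (dV_differentiable : forall t, 0 <= t ->
      forall x, differentiable (dV (rho t)) x)
    (pairing_defined : forall t, 0 <= t ->
      lebesgue_T.-integrable setT
        (fun x => (dotT (gradient (dV (rho t)) x) (rho t x *: v t x))%:E))
    (no_flux_at_infinity : forall t, 0 <= t ->
      lebesgue_T.-integrable setT
        (fun x => (dV (rho t) x * `|rho t x *: v t x|)%:E))
    (t : R) (t_ge0 : 0 <= t) :
  has_time_derivative (fun s => V (rho s)) t
    (pairing_vf (gradient (dV (rho t))) (fun x => rho t x *: v t x)).
Proof.
have [_ dflux Ediv cvg_rho] := rho_solution t t_ge0.
have [int_dV _ _] := V_frechet t t_ge0.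
(* The differential pairs integrably with all of [E], in particular with the divergence of the flux,
   which supplies the last integrability condition. *)
rewrite (pairing_gradient (dV_differentiable t t_ge0) dflux
  (no_flux_at_infinity t t_ge0) (pairing_defined t t_ge0) (int_dV _ Ediv)).
apply: (frechet_has_time_derivative (V_frechet t t_ge0)) cvg_rho => // s s0.
by have [] := rho_solution s s0.
Qed.
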